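(* Let $d\geq 2$, and let $K\ge 1$, $0<r\le 1$, $h>0$, $u>0$. There exist constants $\gamma\in(0,\frac12)$ and $C_1,C_2,\delta>0$, depending only on $d,u,K,r,h$, such that the following holds. Let $\mathfrak X\subset\mathbb R^d$ be an infinite set with $0\in\mathfrak X$, let $\mathcal L\subset\mathbb R^d$ be a two-dimensional linear subspace, let $\ell\in\mathbb S^{d-1}\cap\mathcal L$, and let $X=(X_n,n\ge 0)$ be an $\mathfrak X$-valued process adapted to a filtration $\mathcal F=(\mathcal F_n,n\ge0)$ which is a $(u,\ell,\mathcal L)$-strongly directed submartingale, is uniformly elliptic with constants $h,r$, and has jumps uniformly bounded by $K$. Then for any $x\in\mathfrak X$ $$\mathbb P_x[L_n(x)>n^\gamma]\le C_1e^{-C_2n^\delta}$$ and $$\mathbb P\big[|\mathcal R_n|<n^{1-\gamma}\big]\le C_1\,n\,e^{-C_2n^\delta}$$ for all $n$.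
   Context: $\|\cdot\|$ is the Euclidean norm on $\mathbb R^d$, $\mathbb S^{d-1}$ the unit sphere, $x\cdot y$ the scalar product, $|A|$ the cardinality of $A$. The process $X$ is not assumed to be Markovian or homogeneous in space or time. $\mathbb P_x$ means that the initial state of the process is assumed to be $x$ (i.e. the inequality is asserted for processes as described with $X_0=x$ a.s.); $\mathbb P$ without a subscript means no assumption is made on the initial state. Local time and range: $L_n(x)=\sum_{k=0}^n\mathbf 1_{\{X_k=x\}}$ is the number of visits to $x$ by time $n$, and $\mathcal R_n=\{X_0,\dots,X_n\}$ is the set of sites visited by time $n$. Drift: $D_n=\mathbb E(X_{n+1}-X_n\mid\mathcal F_n)\in\mathbb R^d$. Uniformly bounded jumps (constant $K$): $\|X_{n+1}-X_n\|\le K$ a.s. for all $n$. Uniformly elliptic (constants $h,r$): for all $n$ and all $\ell'\in\mathbb S^{d-1}$, $\mathbb P[(X_{n+1}-X_n)\cdot\ell'>r\mid\mathcal F_n]>h$ a.s. Strongly directed submartingale: let $\mathcal P_{\mathcal L}$ be the orthogonal projection onto the two-dimensional subspace $\mathcal L$, and for $\ell\in\mathbb S^{d-1}\cap\mathcal L$, $u\in\mathbb R$ let $$H^u_{\ell,\mathcal L}=\Big\{x\in\mathbb R^d:\ \mathcal P_{\mathcal L}x=0\ \text{ or }\ \frac{\mathcal P_{\mathcal L}x\cdot\ell}{\|\mathcal P_{\mathcal L}x\|}\ge u\Big\}.$$ $X$ is a $(u,\ell,\mathcal L)$-strongly directed submartingale if $u>0$ and, for all $n$, $\mathbb P[D_n\in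 H^u_{\ell,\mathcal L}\mid\mathcal F_n]=1$ a.s. *)

(* Defs.v *)
From HB Require Import structures.
From mathcomp Require Import all_boot all_order all_algebra finmap.
From mathcomp Require Import all_classical all_reals all_analysis.
From mathcomp Require Import measurable_realfun.

Set Implicit Arguments.
Unset Strict Implicit.
Unset Printing Implicit Defensive.

Import Order.TTheory GRing.Theory Num.Theory numFieldNormedType.Exports.

Local Open Scope classical_set_scope.
Local Open Scope ring_scope.

Section Euclidean.
Context {R : realType} {d : nat}.
Implicit Types (x y z : 'rV[R]_d) (L : {vspace 'rV[R]_d}).

Definition dotp x y : R := \sum_(i < d) x 0 i * y 0 i.

(* The library's norm `|x| on row vectors is the sup norm. *)
Definition enorm x : R := Num.sqrt (dotp x x).

Definition is_orth_proj L x y : Prop :=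
  y \in L /\ forall z, z \in L -> dotp (x - y) z = 0.

(* is_orth_proj L x has exactly one element: orth_projP, is_orth_proj_uniq.
   The library's projv is the projection along some unspecified complement. *)
Definition orth_proj L x : 'rV[R]_d := xget 0 [set y | is_orth_proj L x y].

Lemma dotpE x y : dotp x y = (x *m y^T) 0 0.
Proof. by rewrite mxE; apply: eq_bigr => i _; rewrite mxE. Qed.

Lemma dotp_eq0 x : dotp x x = 0 -> x = 0.
Proof.
move=> /eqP; rewrite psumr_eq0 => [/allP x0|i _]; last by rewrite -expr2 sqr_ge0.
apply/rowP => i; rewrite mxE.
by have := x0 i (mem_index_enum i); rewrite /= mulf_eq0 orbb => /eqP.
Qed.

Lemma dotpBl x y z : dotp (x - y) z = dotp x z - dotp y z.
Proof. by rewrite !dotpE mulmxBl !mxE. Qed.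

Lemma is_orth_proj_uniq L x y y' :
  is_orth_proj L x y -> is_orth_proj L x y' -> y = y'.
Proof.
move=> [yL yo] [y'L y'o]; apply/eqP; rewrite -subr_eq0; apply/eqP/dotp_eq0.
have yy'L : y - y' \in L by exact: rpredB.
move: (yo _ yy'L) (y'o _ yy'L); set w := y - y' in yy'L *.
rewrite [dotp (x - y) w]dotpBl [dotp (x - y') w]dotpBl.
move=> /subr0_eq xy /subr0_eq xy'.
by rewrite {1}/w dotpBl -xy -xy' subrr.
Qed.

Lemma is_orth_proj_ex L x : exists y, is_orth_proj L x y.
Proof.
pose B : 'M[R]_(\dim L, d) := \matrix_i (vbasis L)`_i.
have rowBL i : row i B \in L.
  by rewrite rowK; apply: vbasis_mem; rewrite mem_nth ?size_tuple.
have vBL (v : 'rV_(\dim L)) : v *m B \in L.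
  by rewrite mulmx_sum_row rpred_sum // => i _; rewrite rpredZ.
have LvB z : z \in L -> exists v : 'rV_(\dim L), z = v *m B.
  move=> zL; exists (\row_i coord (vbasis L) i z).
  rewrite mulmx_sum_row {1}(coord_vbasis zL).
  by apply: eq_bigr => i _; rewrite rowK !mxE.
have freeB : row_free B.
  apply/row_freeP.
  have /freeP fB := basis_free (vbasisP L).
  apply/row_freeP; rewrite -kermx_eq0; apply/eqP/row_matrixP => j.
  rewrite row0; set v := row j _.
  have vB0 : v *m B = 0 by apply/sub_kermxP; exact: row_sub.
  apply/rowP => i; rewrite [RHS]mxE; apply: (fB (fun i => v 0 i)).
  rewrite -[RHS]vB0 mulmx_sum_row.
  by apply: eq_bigr => k _; rewrite rowK.
have unitG : B *m B^T \in unitmx.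
  rewrite -row_free_unit -kermx_eq0; apply/eqP/row_matrixP => j.
  rewrite row0; set v := row j _.
  have vG0 : v *m (B *m B^T) = 0 by apply/sub_kermxP; exact: row_sub.
  have vB0 : v *m B = 0.
    apply: dotp_eq0; rewrite dotpE trmx_mul mulmxA -(mulmxA v) vG0.
    by rewrite mul0mx mxE.
  by apply: (row_free_inj freeB); rewrite vB0 mul0mx.
exists (x *m B^T *m invmx (B *m B^T) *m B); split=> // z /LvB[v ->].
rewrite dotpE trmx_mul mulmxA mulmxBl -[X in _ - X]mulmxA mulmxKV //.
by rewrite subrr mul0mx mxE.
Qed.

Lemma orth_projP L x : is_orth_proj L x (orth_proj L x).
Proof.
have [y Ly] := is_orth_proj_ex L x.
by apply: (@xgetPex _ 0 [set y | is_orth_proj L x y]); exists y.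
Qed.

(* H^u_(l,L); the division only matters when orth_proj L x <> 0. *)
Definition directed_cone L (l : 'rV[R]_d) (u : R) : set 'rV[R]_d :=
  [set x | orth_proj L x = 0 \/
           u <= dotp (orth_proj L x) l / enorm (orth_proj L x)].

End Euclidean.

Section ConditionalExpectation.
Context {disp : measure_display} {Omega : measurableType disp} {R : realType}.
Implicit Types (P : probability Omega R) (G : set (set Omega))
  (f g : Omega -> R) (A : set Omega).

Definition is_cond_exp P G f g : Prop :=
  [/\ measurable_fun (setT : set (g_sigma_algebraType G)) g,
      P.-integrable setT (EFin \o g) &
      forall A, G A ->
        (\int[P]_(w in A) (g w)%:E = \int[P]_(w in A) (f w)%:E)%E].

(* A version of E(f | G), which exists (cond_expP) for f integrable. *)
Definition cond_exp P G f : Omega -> R :=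
  xget (cst 0) [set g | is_cond_exp P G f g].

Definition cond_prob P G A : Omega -> R := cond_exp P G (\1_A).

Lemma cond_expP P G f :
  sigma_algebra setT G -> G `<=` measurable -> P.-integrable setT (EFin \o f) ->
  is_cond_exp P G f (cond_exp P G f).
Proof.
move=> sG Gm intf.
suff [g Hg] : exists g, is_cond_exp P G f g.
  by apply: (@xgetPex _ (cst 0) [set g | is_cond_exp P G f g]); exists g.
pose toG : Omega -> g_sigma_algebraType G := id.
have mG A : G.-sigma.-measurable A <-> G A.
  by rewrite measurable_g_measurableTypeE.
have mtoG : measurable_fun setT toG.
  by move=> _ A /mG GA; rewrite setTI; exact: Gm.
have nuP : induced_charge intf `<< P.
  apply/null_content_dominatesP => A mA PA; rewrite /induced_charge.
  apply: null_set_integral => //; have /integrableP[mf _] := intf.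
  exact: measurable_funS mf.
unshelve epose (nu := [the {charge set _ -> \bar R} of
  pushforward (induced_charge intf) toG]); first exact: mtoG.
pose X : {mfun Omega >-> g_sigma_algebraType G} :=
  MeasurableFun.Pack
    (MeasurableFun.Class (isMeasurableFun.Build _ _ _ _ _ mtoG)).
pose mu := distribution P X.
have numu : nu `<< mu by exact: dominates_pushforward.
pose g := Radon_Nikodym nu mu.
have gfin w : g w \is a fin_num by exact: Radon_Nikodym_fin_num.
have intg : mu.-integrable setT g by exact: Radon_Nikodym_integrable.
have mg := measurable_int _ intg.
have gE : EFin \o (fine \o g) = g by apply/funext => w /=; rewrite fineK.
have mgO := measurableT_comp mg mtoG.
have Pg : P.-integrable setT (g \o toG).
  apply/integrableP; split => //.
  case/integrableP : intg => _; rewrite ge0_integral_distribution //.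
  exact: measurableT_comp.
exists (fine \o g); split.
- exact: measurableT_comp.
- by rewrite gE.
- move=> A GA.
  have mA : G.-sigma.-measurable A by apply/mG.
  transitivity (\int[P]_(w in toG @^-1` A) (g \o toG) w)%E.
    by apply: eq_integral => w _; rewrite /= fineK.
  rewrite -(@integral_pushforward _ _ _ _ _ toG mtoG) //.
    by rewrite -[LHS](Radon_Nikodym_integral numu mA).
  by apply: (integrableS measurableT) => //; exact: Gm.
Qed.

End ConditionalExpectation.

Section Process.
Context {disp : measure_display} {Omega : measurableType disp} {R : realType}
  {d : nat}.
Implicit Types (P : probability Omega R) (F : nat -> set (set Omega))
  (X : nat -> Omega -> 'rV[R]_d) (L : {vspace 'rV[R]_d}) (l : 'rV[R]_d).

Definition is_filtration F : Prop :=
  [/\ forall n, sigma_algebra setT (F n),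
      forall n, F n `<=` measurable &
      forall m n, (m <= n)%N -> F m `<=` F n].

(* Borel measurability in R^d, expressed coordinatewise. *)
Definition adapted F X : Prop :=
  forall n (i : 'I_d),
    measurable_fun (setT : set (g_sigma_algebraType (F n)))
      (fun w => X n w 0 i).

Definition incr X n (w : Omega) : 'rV[R]_d := X n.+1 w - X n w.

(* D_n = E(X_(n+1) - X_n | F_n), coordinatewise. *)
Definition drift P F X n (w : Omega) : 'rV[R]_d :=
  \row_i cond_exp P (F n) (fun w' => incr X n w' 0 i) w.

Definition strongly_directed_submartingale P F X (u : R) l L : Prop :=
  0 < u /\
  forall n, {ae P, forall w,
    cond_prob P (F n) [set w' | directed_cone L l u (drift P F X n w')] w = 1}.

Definition uniformly_elliptic P F X (h r : R) : Prop :=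
  forall n (l' : 'rV[R]_d), enorm l' = 1 ->
    {ae P, forall w,
      h < cond_prob P (F n) [set w' | r < dotp (incr X n w') l'] w}.

Definition bounded_jumps P X (K : R) : Prop :=
  forall n, {ae P, forall w, enorm (incr X n w) <= K}.

Definition local_time X n (x : 'rV[R]_d) (w : Omega) : nat :=
  (\sum_(k < n.+1) (X k w == x))%N.

Definition visited X n (w : Omega) : {fset 'rV[R]_d} :=
  [fset X k w | k : 'I_n.+1 in 'I_n.+1]%fset.

End Process.

(* Main.v *)
Require Import Defs.
From mathcomp Require Import all_boot all_order all_algebra finmap.
From mathcomp Require Import all_classical all_reals all_analysis.
From mathcomp Require Import measurable_realfun ring lra.

Set Implicit Arguments.
Unset Strict Implicit.
Unset Printing Implicit Defensive.

Import Order.TTheory GRing.Theory Num.Theory numFieldNormedType.Exports.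

Local Open Scope classical_set_scope.
Local Open Scope ring_scope.

(* Let Y = (Y1, Y2) be the coordinates of the projection of X to L in an
   orthonormal basis (l, l2). The drift condition makes Y1 + u Y2 and Y1 - u Y2
   submartingales. As the tangential part of the increments has a second moment
   bounded below by ellipticity, (y1 + (u/4) |y|) |y|^(-2a) is, for small a > 0,
   a submartingale for Y away from the origin; it has order |y|^(1-2a). Hence,
   from 0, Y reaches distance of order sqrt n inside the region where it is
   positive with probability at least c n^(-(1/2-a)). There one of Y1 + u Y2 and
   Y1 - u Y2 has order sqrt n, so by Chebyshev's inequality Y then misses 0
   during n steps with probability at least 1/2. The number of visits to 0 up to
   time n is thus dominated by a geometric variable, and exceeds n^(1/2-a/2) with
   probability of order exp(-c n^(a/2)). If the range is small, some site is
   visited often, and a union bound over the time of its first visit applies. *)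

(** No Markov property is available, so nothing is stated at a stopping time. The estimates on the
    walk are inequalities over an arbitrary event of [F k], proved by induction on the remaining
    number of steps; splitting the event plays the part of stopping. A linear function in place of
    the Lyapunov function would only give an escape probability of order n^(-1/2). The gain of n^a
    rests on a balance of two second order effects at distance |y|: the factor |y|^(-2a) costs a
    constant times a K^2 / |y|, while ellipticity makes the term (u/4) |y|, through the convexity of
    the norm, earn a constant times u h r^2 / |y|. Hence the condition 1856 a K^2 <= u (h r^2 / 4).
    The first order terms are harmless because the gradient stays in the cone spanned by (1, u) and
    (1, -u); this is what u > 0 buys, and why the tilt is only u/4. The site that is visited often
    is random. The planar walk is therefore the process re-rooted at its own position at time k,
    with constants that do not depend on k. *)

Section RealAnalysis.
Context {R : realType}.
Implicit Types a t x y z p m : R.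

(** * Real estimates for one step of the Lyapunov function *)

Lemma ln1p_bounds t : `|t| <= 1/2 -> t - 2 * t ^+ 2 <= ln (1 + t) <= t.
Proof.
move=> ht; have t0 : 0 < 1 + t by move: ht; rewrite ler_norml; lra.
apply/andP; split; last first.
  have := expR_ge1Dx (ln (1 + t)); rewrite lnK ?posrE //; lra.
have i0 : 0 < (1 + t)^-1 by rewrite invr_gt0.
have := expR_ge1Dx (ln (1 + t)^-1); rewrite lnK ?posrE // lnV ?posrE //.
suff : (1 + t)^-1 <= 1 - t + 2 * t ^+ 2 by lra.
rewrite -[leLHS]mul1r ler_pdivrMr //.
move: ht; rewrite ler_norml; nra.
Qed.

(** The remainder keeps the factor [a], so that a small [a] makes the cost of the power small
    against the gain from the norm. Besides the bounds on ln, only exp x >= 1 + x enters, used at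
    [a * ln (1 + t)] and at its opposite. *)
Lemma powR1p_bounds a t : 0 < a <= 1/4 -> `|t| <= 1/2 ->
  `|(1 + t) `^ (- a) - 1 + a * t| <= 4 * a * t ^+ 2.
Proof.
move=> /andP[a0 a1] ht; have /andP[l1 l2] := ln1p_bounds ht.
move: ht; rewrite ler_norml => /andP[t1 t2].
have t0 : 0 < 1 + t by lra.
rewrite /powR gt_eqF //.
have e1 := expR_ge1Dx (- a * ln (1 + t)).
have e2 := expR_ge1Dx (- (- a * ln (1 + t))).
move: e1 e2; rewrite [in X in _ -> X -> _]expRN; set E := expR _; set L := ln _.
have E0 : 0 < E by exact: expR_gt0.
move=> e1 e2.
have aL : a * L <= a * t by rewrite ler_pM2l.
have b1 : 1 - a * t <= E by rewrite mulNr in e1; lra.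
have b2 : E <= 1 - a * t + 4 * a * t ^+ 2.
  (* [x] is a lower bound for [a * L], so [E] is at most 1 / (1 + x), itself at most 1 - x + 2
     x^2. *)
  set x := a * t - 2 * a * t ^+ 2.
  have xle : x <= a * L.
    have -> : x = a * (t - 2 * t ^+ 2) by rewrite /x; ring.
    by rewrite ler_pM2l.
  have x1 : -1/4 <= x <= 1/8.
    rewrite /x; apply/andP; split; nra.
  have e3 : (1 + x) * E <= 1.
    have : (1 + x) <= E^-1 by move: e2; rewrite mulNr opprK; lra.
    by move=> /(ler_wpM2r (ltW E0)); rewrite mulVf ?gt_eqF.
  have x2 : x ^+ 2 <= a * t ^+ 2.
    have -> : x ^+ 2 = (a * t ^+ 2) * (a * (1 - 2 * t) ^+ 2) by rewrite /x; ring.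
    rewrite ler_piMr //; first by rewrite mulr_ge0 ?sqr_ge0 // ltW.
    have : (1 - 2 * t) ^+ 2 <= 4 by nra.
    have := sqr_ge0 (1 - 2 * t); nra.
  have e4 : 1 <= (1 + x) * (1 - x + 2 * x ^+ 2).
    by move: x1 => /andP[x1 x1']; have := sqr_ge0 x; nra.
  have x0 : 0 < 1 + x by lra.
  have : E <= 1 - x + 2 * x ^+ 2.
    by rewrite -(ler_pM2l x0); exact: le_trans e3 e4.
  by move=> h; apply: (le_trans h); move: x2; rewrite /x; lra.
rewrite ler_norml; apply/andP; split; last by lra.
have := mulr_ge0 (ltW a0) (sqr_ge0 t); lra.
Qed.

(* Only a lower bound linear in the radial part [p] and quadratic in the
   tangential part [m] is needed, so no third order Taylor term appears. *)
Lemma hypot_lower x p m (K : R) : 0 < K -> 8 * K <= x -> `|p| <= K -> `|m| <= K ->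
  x + p + m ^+ 2 / (4 * x) <= Num.sqrt ((x + p) ^+ 2 + m ^+ 2).
Proof.
rewrite !ler_norml => K0 Kx hp hm.
have x0 : 0 < x by lra.
have m2 : m ^+ 2 <= K * x by nra.
set w := m ^+ 2 / (4 * x).
have w0 : 0 <= w by rewrite /w divr_ge0 ?sqr_ge0 //; lra.
have wE : m ^+ 2 = w * (4 * x) by rewrite /w divfK //; apply/eqP; lra.
have wK : w <= K / 4.
  rewrite /w ler_pdivrMr; last by lra.
  nra.
rewrite -[leLHS]ger0_norm; last by lra.
rewrite -sqrtr_sqr ler_wsqrtr // wE.
have : w ^+ 2 <= w * (K / 4) by rewrite expr2 ler_wpM2l.
nra.
Qed.

(** [x] stands for the norm of the position and [x'] for the next one, [p] and [m] for the radial
    and tangential parts of the increment, [th] for (1 + t)^(-a) with [t] the relative change of the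
    squared norm. The terms linear in [xi] and [p] are kept exactly, to be treated through the
    drift. The quadratic errors add up to 116 a K^2 / x; as 464 = 4 * 116, they are at most s c / (4
    x), which is why [c] is subtracted from m^2. *)
Lemma lyapunov_expansion (K c s a x y1 xi p m t th x' : R) :
  0 < K -> 8 * K <= x -> p ^+ 2 + m ^+ 2 <= K ^+ 2 -> `|xi| <= K ->
  0 < s <= 1/4 -> 0 < a -> 464 * a * K ^+ 2 <= s * c -> `|y1| <= x ->
  x + p + m ^+ 2 / (4 * x) <= x' -> x' <= x + K ->
  t = (2 * p * x + (p ^+ 2 + m ^+ 2)) / x ^+ 2 ->
  `|th - 1 + a * t| <= 4 * a * t ^+ 2 ->
  y1 + s * x + (xi + (s - 2 * a * ((y1 + s * x) / x)) * p
     + s / (4 * x) * (m ^+ 2 - c)) <= (y1 + xi + s * x') * th.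
Proof.
move=> K0 Kx pm hxi /andP[s0 s1] a0 ac hy x'l x'u tE hth.
have x0 : 0 < x by lra.
set D := p ^+ 2 + m ^+ 2 in pm tE.
have D0 : 0 <= D by rewrite addr_ge0 ?sqr_ge0.
have p2 : p ^+ 2 <= K ^+ 2 by move: pm; rewrite /D; have := sqr_ge0 m; lra.
have hp : `|p| <= K by rewrite -(ger0_norm (ltW K0)) -ler_sqr ?nnegrE // !real_normK ?num_real.
set G := y1 + s * x; set G' := y1 + xi + s * x'.
set v := x^-1.
have v0 : 0 < v by rewrite invr_gt0.
have vx : v * x = 1 by rewrite mulVf ?gt_eqF.
have tE' : t = v * (2 * p + v * D).
  by rewrite tE /v; field; rewrite gt_eqF.
have Kv : K * v <= 1/8 by rewrite -(ler_pM2r x0) -mulrA vx; lra.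
have vD : 0 <= v * D <= K / 8.
  apply/andP; split; first by rewrite mulr_ge0 // ltW.
  have : v * D <= v * K ^+ 2 by rewrite ler_pM2l.
  have := ler_wpM2r (ltW K0) Kv; rewrite expr2 mulrA (mulrC v K). lra.
have tb : `|t| <= 3 * K * v.
  rewrite tE' normrM (gtr0_norm v0) mulrC ler_pM2r //.
  move: hp; rewrite !ler_norml => hp; lra.
have x'b : x - K <= x'.
  have : 0 <= m ^+ 2 / (4 * x) by rewrite divr_ge0 ?sqr_ge0 //; lra.
  move: hp; rewrite ler_norml => hp; lra.
have x'0 : 0 <= x' by clear -x'b Kx K0; lra.
have x'2 : x' <= 2 * x by clear -x'u Kx K0; lra.
have G'b : `|G'| <= 3 * x.
  move: hy hxi; rewrite !ler_norml /G' => hy hxi.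
  have sx : s * x' <= (1/4) * (2 * x) by apply: ler_pM => //; rewrite ltW.
  have sx0 : 0 <= s * x' by rewrite mulr_ge0 // ltW.
  move: hy hxi K0 Kx sx sx0 {x'l}; move: (s * x') => ?; clear; move=> *.
  lra.
have dG : `|G' - G| <= 2 * K.
  have -> : G' - G = xi + s * (x' - x) by rewrite /G' /G; ring.
  apply: (le_trans (ler_normD _ _)).
  have : `|s * (x' - x)| <= 1 * K.
    rewrite normrM ler_pM //; first by rewrite ger0_norm; clear -s0 s1; lra.
    by rewrite ler_norml; clear -x'b x'u; lra.
  lra.
have Gb : `|G| <= 2 * x.
  have sx : s * x <= (1/4) * x by rewrite ler_pM2r.
  have sx0 : 0 <= s * x by rewrite mulr_ge0 // ltW.
  move: hy; rewrite !ler_norml /G => hy; lra.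
have e1 : `|G' * (th - 1 + a * t)| <= 108 * a * K ^+ 2 * v.
  rewrite normrM.
  have t2 : t ^+ 2 <= (3 * K * v) ^+ 2.
    by rewrite -[t ^+ 2]real_normK ?num_real // lerXn2r ?nnegrE ?mulr_ge0 // ltW // mulr_gt0.
  have -> : 108 * a * K ^+ 2 * v = (3 * x) * (4 * a * (3 * K * v) ^+ 2).
    by transitivity (108 * a * K ^+ 2 * v * (v * x)); [rewrite vx mulr1|ring].
  apply: ler_pM => //; apply: (le_trans hth).
  by apply: ler_wpM2l => //; rewrite mulr_ge0 // ltW.
have e2 : `|a * t * (G' - G)| <= 6 * a * K ^+ 2 * v.
  have -> : 6 * a * K ^+ 2 * v = (a * (3 * K * v)) * (2 * K) by ring.
  by rewrite normrM ler_pM // normrM (gtr0_norm a0) ler_pM2l.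
have e3 : `|a * v ^+ 2 * D * G| <= 2 * a * K ^+ 2 * v.
  have -> : 2 * a * K ^+ 2 * v = (a * v ^+ 2 * K ^+ 2) * (2 * x).
    by transitivity (2 * a * K ^+ 2 * v * (v * x)); [rewrite vx mulr1|ring].
  have av : 0 <= a * v ^+ 2 by rewrite mulr_ge0 ?sqr_ge0 // ltW.
  by rewrite normrM ler_pM // normrM (ger0_norm av) (ger0_norm D0) ler_wpM2l.
have e4 : 116 * a * K ^+ 2 * v <= s / 4 * v * c.
  have : 464 * a * K ^+ 2 * v <= s * c * v by rewrite ler_pM2r.
  lra.
(* Three error terms: the Taylor remainder, the change from [G] to [G'] in the linear term and, once
   [a * t * G] is expanded, the quadratic part of [t]. *)
have -> : G' * th = G' + G' * (th - 1 + a * t) - a * t * (G' - G) - a * t * G by ring.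
have -> : a * t * G = 2 * a * (G * v) * p + a * v ^+ 2 * D * G by rewrite tE'; ring.
have sx' : s * (x + p + m ^+ 2 / (4 * x)) <= s * x' by rewrite ler_pM2l.
have m4 : m ^+ 2 / (4 * x) = 1/4 * v * m ^+ 2 by rewrite /v; field; rewrite gt_eqF.
have s4 : s / (4 * x) = s / 4 * v by rewrite /v; field; rewrite gt_eqF.
have G'G : G' = G + xi + s * (x' - x) by rewrite /G' /G; ring.
rewrite m4 in sx'; rewrite s4 -/v -/G.
move: e1 e2 e3; rewrite !ler_norml.
move: (G' * (th - 1 + a * t)) (a * t * (G' - G)) (a * v ^+ 2 * D * G).
move=> A1 A2 A3 /andP[e1 _] /andP[_ e2] /andP[_ e3]; rewrite G'G.
have -> : (s - 2 * a * (G * v)) * p = s * p - 2 * a * (G * v) * p by ring.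
have -> : s / 4 * v * (m ^+ 2 - c) = s / 4 * v * m ^+ 2 - s / 4 * v * c by ring.
have {}sx' : s * p + s / 4 * v * m ^+ 2 <= s * (x' - x).
  by rewrite -subr_ge0 in sx'; rewrite -subr_ge0 (_ : _ - _ = s * x' - s * (x + p + 1 / 4 * v * m ^+ 2)) //; ring.
clear -e1 e2 e3 e4 sx'; move: e1 e2 e3 e4 sx'.
have -> : 108 * a * K ^+ 2 * v = 108 * (a * K ^+ 2 * v) by ring.
have -> : 6 * a * K ^+ 2 * v = 6 * (a * K ^+ 2 * v) by ring.
have -> : 2 * a * K ^+ 2 * v = 2 * (a * K ^+ 2 * v) by ring.
have -> : 116 * a * K ^+ 2 * v = 116 * (a * K ^+ 2 * v) by ring.
move: (a * K ^+ 2 * v) (s / 4 * v * c) (s / 4 * v * m ^+ 2) (s * p) (s * (x' - x)).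
move: (2 * a * (G * v) * p); rewrite {}/G; move: (y1 + s * x) => G.
move=> r1 r2 r3 r4 r5 r6; lra.
Qed.

(** Homogeneous of degree 1 - 2a. For 0 < s < 1 it is positive on a cone of opening larger than pi,
    and the positive harmonic functions vanishing on the boundary of such a cone grow with an
    exponent below 1; this is the room for the factor |y|^(-2a). *)
Definition lyapunov (s a y1 y2 : R) : R :=
  (y1 + s * Num.sqrt (y1 ^+ 2 + y2 ^+ 2)) * (y1 ^+ 2 + y2 ^+ 2) `^ (- a).

Lemma norm_le_hypot x y : `|x| <= Num.sqrt (x ^+ 2 + y ^+ 2).
Proof. by rewrite -sqrtr_sqr ler_wsqrtr // lerDl sqr_ge0. Qed.

(** Resolving the increment along the position reduces the claim to [lyapunov_expansion] with s =
    u/4; hence 1856 = 4 * 464. The coefficient [b] differs from u/4 by at most 4a, and c <= K^2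
    turns the condition on [a] into 1856 a <= u, so |b| <= u/2. Beyond radius 8K the relative change
    [t] is at most 1/2. *)
Lemma lyapunov_step (K c u a y1 y2 xi et : R) :
  0 < K -> c <= K ^+ 2 -> 0 < u <= 1 ->
  0 < a -> 1856 * a * K ^+ 2 <= u * c ->
  (8 * K) ^+ 2 <= y1 ^+ 2 + y2 ^+ 2 -> xi ^+ 2 + et ^+ 2 <= K ^+ 2 ->
  let q := y1 ^+ 2 + y2 ^+ 2 in
  let x := Num.sqrt q in
  let b := u / 4 - 2 * a * ((y1 + u / 4 * x) / x) in
  `|b| <= u / 2 /\
  lyapunov (u / 4) a y1 y2 + q `^ (- a) *
    (xi + b * ((y1 * xi + y2 * et) / x)
     + u / 4 / (4 * x) * (((- y2 * xi + y1 * et) / x) ^+ 2 - c))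
  <= lyapunov (u / 4) a (y1 + xi) (y2 + et).
Proof.
move=> K0 cK /andP[u0 u1] a0 ac qK dK.
have a1 : 1856 * a <= u.
  rewrite -(ler_pM2r (exprn_gt0 2 K0)); apply: (le_trans ac).
  by rewrite ler_pM2l.
move=> q x b.
have q0 : 0 < q by apply: lt_le_trans qK; rewrite exprn_gt0 // mulr_gt0.
have x0 : 0 < x by rewrite sqrtr_gt0.
have xK : 8 * K <= x by rewrite -(@ger0_norm _ (8 * K)) -?sqrtr_sqr ?ler_wsqrtr // mulr_ge0 // ltW.
have xE : x ^+ 2 = q by rewrite sqr_sqrtr // ltW.
have y1x : `|y1| <= x by exact: norm_le_hypot.
have Gx : `|(y1 + u / 4 * x) / x| <= 2.
  rewrite normrM normfV (gtr0_norm x0) ler_pdivrMr // (le_trans (ler_normD _ _)) //.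
  rewrite normrM (gtr0_norm x0) ger0_norm; last by lra.
  have : u / 4 * x <= 1 * x by rewrite ler_pM2r //; lra.
  lra.
split.
  rewrite /b; have : `|2 * a * ((y1 + u / 4 * x) / x)| <= 2 * a * 2.
    by rewrite normrM ger0_norm ?ler_pM2l ?mulr_gt0 // mulr_ge0 // ltW.
  move: (2 * a * (_ / x)) => w; rewrite !ler_norml; clear -u0 a1 a0; lra.
set p := (y1 * xi + y2 * et) / x; set m := (- y2 * xi + y1 * et) / x.
have pm : p ^+ 2 + m ^+ 2 = xi ^+ 2 + et ^+ 2.
  rewrite /p /m !expr_div_n xE /q; field.
  by rewrite -/q gt_eqF.
have px : p * x = y1 * xi + y2 * et by rewrite /p divfK // gt_eqF.
set q' := (y1 + xi) ^+ 2 + (y2 + et) ^+ 2.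
have q'E : q' = (x + p) ^+ 2 + m ^+ 2.
  transitivity (q + 2 * (p * x) + (p ^+ 2 + m ^+ 2)); last by rewrite -xE; ring.
  by rewrite px pm /q' /q; ring.
pose t := (2 * p * x + (p ^+ 2 + m ^+ 2)) / x ^+ 2.
have q't : q' = q * (1 + t).
  rewrite q'E /t -xE; field; by rewrite gt_eqF.
have sqK z : z ^+ 2 <= K ^+ 2 -> `|z| <= K.
  by move=> h; rewrite -(ger0_norm (ltW K0)) -ler_sqr ?nnegrE // !real_normK ?num_real.
have hxi : `|xi| <= K by apply: sqK; apply: le_trans dK; rewrite lerDl sqr_ge0.
have hp : `|p| <= K by apply: sqK; apply: le_trans dK; rewrite -pm lerDl sqr_ge0.
have hm : `|m| <= K by apply: sqK; apply: le_trans dK; rewrite -pm lerDr sqr_ge0.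
have tb : `|t| <= 1/2.
  rewrite /t normrM (@gtr0_norm _ (_^-1)) ?invr_gt0 ?exprn_gt0 //.
  rewrite ler_pdivrMr ?exprn_gt0 //.
  have pKx : `|p * x| <= K * x by rewrite normrM (gtr0_norm x0) ler_pM2r.
  have KKx : K * K <= K * x by rewrite ler_pM2l //; clear -xK K0; lra.
  have Kxx : (8 * K) * x <= x * x by rewrite ler_pM2r.
  move: pKx; rewrite pm !ler_norml -mulrA => pKx.
  have := sqr_ge0 xi; have := sqr_ge0 et.
  rewrite !expr2 in dK *; clear -pKx KKx Kxx dK; lra.
have a14 : 0 < a <= 1/4 by rewrite a0 /=; clear -a1 u1; lra.
have t0 : 0 <= 1 + t by move: tb; rewrite ler_norml; clear; move: t => t; lra.
have th := powR1p_bounds a14 tb.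
have ex : x + p + m ^+ 2 / (4 * x) <= Num.sqrt q'.
  by rewrite q'E; apply: (@hypot_lower _ _ _ K).
have ex' : Num.sqrt q' <= x + K.
  have xK0 : 0 <= x + K by rewrite addr_ge0 ?sqrtr_ge0 // ltW.
  rewrite q'E -[leRHS](ger0_norm xK0) -sqrtr_sqr ler_wsqrtr // -subr_ge0.
  have -> : (x + K) ^+ 2 - ((x + p) ^+ 2 + m ^+ 2) =
    2 * ((K - p) * x) + (K ^+ 2 - (p ^+ 2 + m ^+ 2)) by ring.
  rewrite addr_ge0 ?subr_ge0 ?pm // !mulr_ge0 ?sqrtr_ge0 // subr_ge0.
  exact: le_trans (ler_norm _) hp.
have ucs : 0 < u / 4 <= 1/4 by clear -u0 u1; lra.
have acs : 464 * a * K ^+ 2 <= u / 4 * c by clear -ac; lra.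
have pmK : p ^+ 2 + m ^+ 2 <= K ^+ 2 by rewrite pm.
have := @lyapunov_expansion K c (u/4) a x y1 xi p m t _ _ K0 xK pmK hxi ucs a0 acs y1x ex ex' erefl th.
rewrite /lyapunov -/q -/q' -/x -/b q't powRM ?(ltW q0) // -q't => h.
rewrite [X in X + _]mulrC -mulrDr (mulrCA _ (q `^ _)) ler_pM2l ?powR_gt0 //.
Qed.

Lemma lyapunov_le s a y1 y2 : 0 <= s <= 1 -> 0 < a <= 1/2 ->
  lyapunov s a y1 y2 <= 2 * (y1 ^+ 2 + y2 ^+ 2) `^ (1/2 - a).
Proof.
move=> /andP[s0 s1] /andP[a0 a1]; rewrite /lyapunov; set q := y1 ^+ 2 + y2 ^+ 2.
have q0 : 0 <= q by rewrite addr_ge0 ?sqr_ge0.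
have [q00|qn0] := eqVneq q 0.
  by rewrite q00 powR0 ?oppr_eq0 ?gt_eqF // mulr0 mulr_ge0 ?powR_ge0.
rewrite powRD; last by rewrite qn0 implybT.
rewrite mulrA ler_wpM2r ?powR_ge0 //.
rewrite (_ : 1 / 2 = 2^-1 :> R) ?powR12_sqrt //; last by rewrite mul1r.
have := norm_le_hypot y1 y2; rewrite -/q ler_norml => /andP[_ h].
have : s * Num.sqrt q <= 1 * Num.sqrt q by rewrite ler_wpM2r ?sqrtr_ge0.
lra.
Qed.

Lemma le_lyapunov s a y1 y2 (T : R) : 0 <= s -> 0 <= a -> 0 < y1 ->
  y1 ^+ 2 + y2 ^+ 2 <= T ->
  y1 * T `^ (- a) <= lyapunov s a y1 y2.
Proof.
move=> s0 a0 y0 qT; have q0 : 0 < y1 ^+ 2 + y2 ^+ 2.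
  by rewrite ltr_pwDl ?exprn_gt0 ?sqr_ge0.
apply: ler_pM; rewrite ?powR_ge0 ?(ltW y0) //.
  by rewrite lerDl mulr_ge0 ?sqrtr_ge0.
have T0 : 0 < T by exact: lt_le_trans qT.
rewrite !powRN lef_pV2 ?posrE ?powR_gt0 //.
by rewrite ge0_ler_powR ?nnegrE // ltW.
Qed.

(** The tilt u/4 is small against u: where y1 < 0, positivity gives |y1| < u |y| / 4, so y2 carries
    most of the norm and y1 + u |y2| >= u |y| (1 - 1/4 - u/4) >= u |y| / 2. The sign of y2 decides
    the side. *)
Lemma lyapunov_gt0_side (u a y1 y2 N : R) : 0 < u <= 1 -> 0 <= N ->
  N ^+ 2 <= y1 ^+ 2 + y2 ^+ 2 -> 0 < lyapunov (u / 4) a y1 y2 ->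
  u / 2 * N <= y1 + u * y2 \/ u / 2 * N <= y1 - u * y2.
Proof.
move=> /andP[u0 u1] N0 Nq; rewrite /lyapunov; set q := y1 ^+ 2 + y2 ^+ 2 => G0.
have G1 : 0 < y1 + u / 4 * Num.sqrt q.
  by rewrite ltNge; apply/negP => h; move: G0; rewrite ltNge mulr_le0_ge0 ?powR_ge0.
have q0 : 0 <= q by rewrite addr_ge0 ?sqr_ge0.
have Nx : N <= Num.sqrt q.
  by rewrite -(ger0_norm N0) -sqrtr_sqr ler_wsqrtr.
set x := Num.sqrt q in G1 Nx *.
have xE : x ^+ 2 = y1 ^+ 2 + y2 ^+ 2 by rewrite sqr_sqrtr.
have x0 : 0 <= x by exact: sqrtr_ge0.
have uN : u / 2 * N <= u / 2 * x by rewrite ler_pM2l //; lra.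
have xy : x <= `|y1| + `|y2|.
  rewrite -(@ler_pXn2r _ 2) ?nnegrE ?addr_ge0 // xE sqrrD !real_normK ?num_real //.
  by rewrite lerD2r lerDl mulrn_wge0 // mulr_ge0.
have key : u / 2 * x <= y1 + u * `|y2|.
  have hy : u * (x - `|y1|) <= u * `|y2| by rewrite ler_pM2l //; lra.
  have hu : u * `|y1| <= 1 * `|y1| by rewrite ler_wpM2r.
  have ux : u * u * x <= u * 1 * x by rewrite ler_wpM2r // ler_pM2l.
  have ux0 : 0 <= u * x by rewrite mulr_ge0 // ltW.
  have [h|h] := lerP 0 y1; first by rewrite ger0_norm // in hy hu xy; lra.
  rewrite ltr0_norm // in hy hu xy.
  have : u * (- y1) <= u * (u / 4 * x) by rewrite ler_pM2l //; lra.
  rewrite mulrBr in hy; lra.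
have [h|h] := lerP 0 y2; [left|right].
  by rewrite ger0_norm // in key; lra.
by rewrite ltr0_norm // in key; lra.
Qed.

(** The right side is (b - dz)^2, with b the shortfall of [z] below [N]. Clipping at 0 caps the
    shortfall at [N], the cost at which the argument stops. *)
Lemma escape_cost_step (N z dz : R) : 0 < z ->
  Num.max (N - Num.max (z + dz) 0) 0 ^+ 2 <=
  Num.max (N - Num.max z 0) 0 ^+ 2 - 2 * (Num.max (N - Num.max z 0) 0 * dz) + dz ^+ 2.
Proof.
move=> z0; rewrite (max_l (ltW z0)).
set b := Num.max (N - z) 0; set b' := Num.max _ 0.
have -> : b ^+ 2 - 2 * (b * dz) + dz ^+ 2 = (b - dz) ^+ 2 by ring.
have b'0 : 0 <= b' by rewrite le_max lexx orbT.
rewrite -[leRHS]real_normK ?num_real // ler_pXn2r ?nnegrE //.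
have zz : z + dz <= Num.max (z + dz) 0 by rewrite le_max lexx.
rewrite /b' ge_max normr_ge0 andbT.
have : `|b - dz| >= b - dz by exact: ler_norm.
have : N - z <= b by rewrite le_max lexx.
lra.
Qed.

Definition radial_slope (u a y1 y2 : R) : R :=
  let x := Num.sqrt (y1 ^+ 2 + y2 ^+ 2) in u / 4 - 2 * a * ((y1 + u / 4 * x) / x).

(* The gradient of [lyapunov (u / 4) a] is
   [push_weight u a u * (1, u) + push_weight u a (- u) * (1, - u)]. *)
Definition push_weight (u a v y1 y2 : R) : R :=
  let x := Num.sqrt (y1 ^+ 2 + y2 ^+ 2) in
  (y1 ^+ 2 + y2 ^+ 2) `^ (- a) *
  ((1 + radial_slope u a y1 y2 * (y1 / x) + radial_slope u a y1 y2 * (y2 / x) / v) / 2).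

Definition curvature_weight (u a y1 y2 : R) : R :=
  (y1 ^+ 2 + y2 ^+ 2) `^ (- a) * (u / 4 / (4 * Num.sqrt (y1 ^+ 2 + y2 ^+ 2))).

(** Since |b| <= u/2, the direction (1, 0) + b y/|y| is a nonnegative combination of (1, u) and (1,
    -u), the two directions in which the drift is controlled. The upper bounds by 1 come from |y| >=
    1, which follows from K >= 1. *)
Lemma lyapunov_step_weights (K c u a y1 y2 xi et : R) :
  1 <= K -> c <= K ^+ 2 -> 0 < u <= 1 ->
  0 < a -> 1856 * a * K ^+ 2 <= u * c ->
  (8 * K) ^+ 2 <= y1 ^+ 2 + y2 ^+ 2 -> xi ^+ 2 + et ^+ 2 <= K ^+ 2 ->
  let x := Num.sqrt (y1 ^+ 2 + y2 ^+ 2) in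
  [/\ 0 <= push_weight u a u y1 y2 <= 1, 0 <= push_weight u a (- u) y1 y2 <= 1,
      0 <= curvature_weight u a y1 y2 <= 1 &
  lyapunov (u / 4) a y1 y2 +
    (push_weight u a u y1 y2 * (xi + u * et) +
     push_weight u a (- u) y1 y2 * (xi + - u * et) +
     curvature_weight u a y1 y2 * ((- (y2 / x) * xi + y1 / x * et) ^+ 2 - c))
  <= lyapunov (u / 4) a (y1 + xi) (y2 + et)].
Proof.
move=> K1 cK u01 a0 ac qK dK x; have /andP[u0 u1] := u01.
have K0 : 0 < K by exact: lt_le_trans K1.
have [bu step] := @lyapunov_step K c u a y1 y2 xi et K0 cK u01 a0 ac qK dK.
set q := y1 ^+ 2 + y2 ^+ 2 in x qK bu step *.
have q1 : 1 <= q.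
  apply: le_trans qK; have : 1 <= 8 * K by clear -K1; lra.
  by move=> K8; rewrite expr2 -{1}[1]mulr1; apply: ler_pM.
have q0 : 0 < q by exact: lt_le_trans q1.
have x0 : 0 < x by rewrite sqrtr_gt0.
have xE : x ^+ 2 = q by rewrite sqr_sqrtr // ltW.
have x1 : 1 <= x by rewrite -sqrtr1 ler_wsqrtr.
have W0 : 0 < q `^ (- a) by rewrite powR_gt0.
have W1 : q `^ (- a) <= 1.
  by rewrite powRN invf_le1 ?powR_gt0 // -(powRr0 q) ler_powR // ltW.
move: step; rewrite /push_weight /curvature_weight -/q -/x /radial_slope -/q -/x.
move: bu; rewrite -/x; set b := u / 4 - _; set W := q `^ (- a) in W0 W1 * => bu step.
have e1 : `|y1 / x| <= 1.
  by rewrite normrM normfV (gtr0_norm x0) ler_pdivrMr // mul1r norm_le_hypot.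
have e2 : `|y2 / x| <= 1.
  rewrite normrM normfV (gtr0_norm x0) ler_pdivrMr // mul1r.
  by rewrite /x /q addrC norm_le_hypot.
have v1 : `|b * (y1 / x)| <= 1/2.
  rewrite normrM; have : `|b| * `|y1 / x| <= u / 2 * 1 by rewrite ler_pM.
  by clear -u1; lra.
have v2 : `|b * (y2 / x) / u| <= 1/2.
  rewrite normrM normfV (gtr0_norm u0) ler_pdivrMr // normrM.
  have : `|b| * `|y2 / x| <= u / 2 * 1 by rewrite ler_pM.
  by clear; lra.
have v3 : 0 <= u / 4 / (4 * x) <= 1.
  have : 0 <= u / 4 / (4 * x) by rewrite !divr_ge0 // ?mulr_ge0 // ltW.
  move=> -> /=; rewrite ler_pdivrMr; last by rewrite mulr_gt0.
  by clear -u1 x1; lra.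
have WP z : 0 <= z <= 1 -> 0 <= W * z <= 1.
  move=> /andP[z0 z1]; rewrite mulr_ge0 ?(ltW W0) //=.
  by rewrite -[leRHS]mulr1; apply: ler_pM => //; exact: ltW.
split; [apply: WP|apply: WP|exact: WP|].
- by move: v1 v2; rewrite !ler_norml; clear; lra.
- by rewrite invrN mulrN; move: v1 v2; rewrite !ler_norml; clear; lra.
apply: le_trans step; rewrite lerD2l le_eqVlt; apply/orP; left; apply/eqP.
by rewrite -/b; field; rewrite !gt_eqF.
Qed.

Lemma sqr_norm_triangle (x1 x2 d1 d2 N K : R) : 0 <= N -> 0 <= K ->
  x1 ^+ 2 + x2 ^+ 2 <= N ^+ 2 -> d1 ^+ 2 + d2 ^+ 2 <= K ^+ 2 ->
  (x1 + d1) ^+ 2 + (x2 + d2) ^+ 2 <= (N + K) ^+ 2.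
Proof.
move=> N0 K0 xN dK.
suff xd : x1 * d1 + x2 * d2 <= N * K by clear -xN dK xd; lra.
have NK : (x1 * d1 + x2 * d2) ^+ 2 <= (N * K) ^+ 2.
  apply: (@le_trans _ _ ((x1 ^+ 2 + x2 ^+ 2) * (d1 ^+ 2 + d2 ^+ 2))).
    rewrite -subr_ge0.
    have -> : (x1 ^+ 2 + x2 ^+ 2) * (d1 ^+ 2 + d2 ^+ 2) - (x1 * d1 + x2 * d2) ^+ 2 =
      (x1 * d2 - x2 * d1) ^+ 2 by ring.
    exact: sqr_ge0.
  by rewrite exprMn ler_pM // addr_ge0 ?sqr_ge0.
have NK0 : 0 <= N * K by exact: mulr_ge0.
apply: (le_trans (ler_norm _)).
by rewrite -[leRHS](ger0_norm NK0) -ler_sqr ?nnegrE // !real_normK ?num_real.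
Qed.

End RealAnalysis.

(** * Expectations of almost surely bounded functions *)

Section Expectation.
Context {disp : measure_display} {Omega : measurableType disp} {R : realType}.
Variable P : probability Omega R.
Implicit Types (f g : Omega -> R) (A B : set Omega) (G : set (set Omega)).

(** The bound holds almost everywhere, as the jumps are bounded only almost surely. The class
    consists of integrable functions and is closed under sums and products. *)
Definition ebounded f :=
  measurable_fun setT f /\ exists C : R, {ae P, forall w, `|f w| <= C}.

Definition Ex f : R := \int[P]_w f w.

Definition pr A : R := fine (P A).

Lemma prE A : measurable A -> P A = (pr A)%:E.
Proof.
by move=> mA; rewrite /pr fineK // fin_num_measure.
Qed.

Lemma ebounded_integrable f : ebounded f -> P.-integrable setT (EFin \o f).
Proof.
move=> [mf [C fC]]; apply/integrableP; split; first exact/measurable_EFinP.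
apply: (@le_lt_trans _ _ (\int[P]_w (Num.max C 0)%:E)%E).
  apply: ae_ge0_le_integral => //.
  - by apply: measurableT_comp => //; exact/measurable_EFinP.
  - by move=> w _; rewrite lee_fin le_max lexx orbT.
  - by apply: filterS fC => w fC _; rewrite /= lee_fin le_max fC.
by rewrite integral_cst //= [X in (_ * X)%E]probability_setT mule1 ltey.
Qed.

Lemma ebounded_cst c : ebounded (fun=> c).
Proof. by split; [exact: measurable_cst|exists `|c|; exact: aeW]. Qed.

Lemma ebounded_indic A : measurable A -> ebounded (\1_A).
Proof.
move=> mA; split; first exact: measurable_indic.
by exists 1; apply: aeW => w; rewrite indicE; case: (_ \in _); rewrite ?normr1 ?normr0.
Qed.

Lemma eboundedD f g : ebounded f -> ebounded g -> ebounded (fun w => f w + g w).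
Proof.
move=> [mf [C fC]] [mg [D gD]]; split; first exact: measurable_funD.
exists (C + D); apply: filterS2 fC gD => w h1 h2.
by rewrite (le_trans (ler_normD _ _)) // lerD.
Qed.

Lemma eboundedM f g : ebounded f -> ebounded g -> ebounded (fun w => f w * g w).
Proof.
move=> [mf [C fC]] [mg [D gD]]; split; first exact: measurable_funM.
exists (C * D); apply: filterS2 fC gD => w h1 h2.
by rewrite normrM ler_pM.
Qed.

Lemma eboundedZ c f : ebounded f -> ebounded (fun w => c * f w).
Proof. by move=> bf; exact: (eboundedM (ebounded_cst c) bf). Qed.

Lemma eboundedB f g : ebounded f -> ebounded g -> ebounded (fun w => f w - g w).
Proof.
move=> bf bg; have -> : (fun w => f w - g w) = (fun w => f w + -1 * g w).
  by apply/funext => w; rewrite mulN1r.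
exact: (eboundedD bf (eboundedZ _ bg)).
Qed.

Lemma ExD f g : ebounded f -> ebounded g -> Ex (fun w => f w + g w) = Ex f + Ex g.
Proof. by move=> bf bg; rewrite /Ex RintegralD //; exact: ebounded_integrable. Qed.

Lemma ExB f g : ebounded f -> ebounded g -> Ex (fun w => f w - g w) = Ex f - Ex g.
Proof. by move=> bf bg; rewrite /Ex RintegralB //; exact: ebounded_integrable. Qed.

Lemma ExZ c f : ebounded f -> Ex (fun w => c * f w) = c * Ex f.
Proof. by move=> bf; rewrite /Ex RintegralZl //; exact: ebounded_integrable. Qed.

Lemma Ex_indic A : measurable A -> Ex (\1_A) = pr A.
Proof.
by move=> mA; rewrite /Ex /Rintegral integral_indic // setIT.
Qed.

Lemma Ex_ge0 f : ebounded f -> {ae P, forall w, 0 <= f w} -> 0 <= Ex f.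
Proof.
move=> [mf _] f0; rewrite /Ex /Rintegral.
rewrite (@ae_eq_integral _ _ _ P setT (fun w => (Num.max (f w) 0)%:E)) //.
- by rewrite fine_ge0 // integral_ge0 // => w _; rewrite lee_fin le_max lexx orbT.
- exact/measurable_EFinP.
- by apply/measurable_EFinP; apply: measurable_funTS; apply: measurable_maxr.
- by apply: filterS f0 => w f0 _ /=; rewrite max_l.
Qed.

Lemma le_Ex f g : ebounded f -> ebounded g -> {ae P, forall w, f w <= g w} ->
  Ex f <= Ex g.
Proof.
move=> bf bg fg; rewrite -subr_ge0 -ExB //; apply: Ex_ge0.
  exact: eboundedB.
by apply: filterS fg => w; rewrite subr_ge0.
Qed.

Lemma pr_ge0 A : 0 <= pr A.
Proof. by rewrite fine_ge0. Qed.

Lemma pr_le1 A : measurable A -> pr A <= 1.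
Proof. by move=> mA; rewrite -lee_fin -prE // probability_le1. Qed.

Lemma le_pr A B : measurable A -> measurable B -> A `<=` B -> pr A <= pr B.
Proof. by move=> mA mB AB; rewrite -lee_fin -!prE // le_measure ?inE. Qed.

Lemma le_pr_ae A B : measurable A -> measurable B ->
  {ae P, forall w, A w -> B w} -> pr A <= pr B.
Proof.
move=> mA mB AB; rewrite -!Ex_indic //.
apply: le_Ex; [exact: ebounded_indic|exact: ebounded_indic|].
apply: filterS AB => w AB; rewrite !indicE.
have [Aw|Aw] := pselect (A w); last by rewrite memNset.
by rewrite mem_set // mem_set //; exact: AB.
Qed.

Lemma prU A B : measurable A -> measurable B -> A `&` B = set0 ->
  pr (A `|` B) = pr A + pr B.
Proof.
by move=> mA mB AB; rewrite /pr measureU // fineD ?fin_num_measure.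
Qed.

(** * Conditioning on a sub-sigma-algebra by testing on its events *)

Section SubSigmaAlgebra.
Variable G : set (set Omega).
Hypotheses (sG : sigma_algebra setT G) (Gm : G `<=` measurable).
Local Notation gmf := (measurable_fun (setT : set (g_sigma_algebraType G))).

Lemma sub_sigma_measurable A : G.-sigma.-measurable A <-> G A.
Proof. by rewrite measurable_g_measurableTypeE. Qed.

Lemma sub_sigma_measurable_fun f : gmf f -> measurable_fun setT f.
Proof. by move=> mf _ B mB; apply: Gm; apply: (sub_sigma_measurable _).1; exact: mf. Qed.

(** Tested form of E[g f] = E[g E[f | G]] >= 0 when E[f | G] >= 0. After n halvings of the range of
    [g], what is left of [g] contributes at least -D c / 2^n, and n is arbitrary. *)
Lemma pull_out_ge0 f g c : ebounded f ->
  (forall A, G A -> 0 <= Ex (fun w => \1_A w * f w)) ->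
  gmf g -> (forall w, 0 <= g w <= c) -> 0 <= Ex (fun w => g w * f w).
Proof.
move=> bf f0 mg gc; have [mf [C fC]] := bf.
have {fC}fC : {ae P, forall w, `|f w| <= Num.max C 0}.
  by apply: filterS fC => w h; rewrite le_max h.
set D := Num.max C 0 in fC; have D0 : 0 <= D by rewrite le_max lexx orbT.
have bgm (h : Omega -> R) (k : R) : gmf h -> (forall w, 0 <= h w <= k) -> ebounded h.
  move=> mh hk; split; first exact: sub_sigma_measurable_fun.
  by exists k; apply: aeW => w; have /andP[h1 h2] := hk w; rewrite ger0_norm.
(* Binary expansion of [g]: peel off half of the remaining range [c] at a time. *)
have H n : forall (h : Omega -> R) (k : R), 0 <= k -> gmf h -> (forall w, 0 <= h w <= k) ->
    - (D * k) / 2 ^+ n <= Ex (fun w => h w * f w).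
  elim: n => [|n IH] h k k0 mh hk.
    have bh := bgm _ _ mh hk.
    rewrite expr0 divr1.
    have -> : - (D * k) = Ex (fun=> - (D * k)).
      by rewrite /Ex Rintegral_cst // [X in fine X]probability_setT /= mulr1.
    apply: le_Ex; [exact: ebounded_cst|exact: eboundedM|].
    apply: filterS fC => w fD; have /andP[h0 h1] := hk w.
    rewrite lerNl (le_trans (ler_norm _)) // normrN normrM (ger0_norm h0) mulrC.
    by rewrite ler_pM.
  pose A := [set w | k / 2 <= h w].
  have mA : G.-sigma.-measurable A.
    have -> : A = setT `&` h @^-1` `[k / 2, +oo[.
      by rewrite setTI; apply/seteqP; split => w /=; rewrite in_itv /= andbT.
    exact: mh.
  have GA : G A by exact/sub_sigma_measurable.
  pose h' w := h w - k / 2 * \1_A w.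
  have mh' : gmf h'.
    apply: measurable_funB => //; exact: measurable_funM.
  have hk' w : 0 <= h' w <= k / 2.
    have /andP[h0 h1] := hk w; rewrite /h' indicE.
    have [kh|kh] := lerP (k / 2) (h w).
      by rewrite mem_set // mulr1; lra.
    by rewrite memNset ?mulr0 => [|/(lt_le_trans kh)]; [lra|rewrite ltxx].
  have bh := bgm _ _ mh hk; have bh' := bgm _ _ mh' hk'.
  have b1 : ebounded (\1_A) by apply: ebounded_indic; exact: Gm.
  have -> : (fun w => h w * f w) = (fun w => h' w * f w + k / 2 * (\1_A w * f w)).
    by apply/funext => w; rewrite /h'; ring.
  rewrite ExD ?ExZ; last 3 first.
  - exact: eboundedM.
  - exact: eboundedM.
  - by apply: eboundedZ; exact: eboundedM.
  apply: (@le_trans _ _ (Ex (fun w => h' w * f w))); last first.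
    by rewrite lerDl mulr_ge0 ?f0 // divr_ge0.
  have k20 : 0 <= k / 2 by rewrite divr_ge0.
  apply: le_trans (IH _ _ k20 mh' hk'); rewrite le_eqVlt; apply/orP; left; apply/eqP.
  by rewrite exprSr invfM; ring.
have c0 : 0 <= c by have /andP[g0 g1] := gc point; exact: le_trans g1.
have {}H n := H n _ _ c0 mg gc.
rewrite leNgt; apply/negP; set x := Ex _ in H * => x0.
have Dc0 : 0 <= D * c by exact: mulr_ge0.
have /(_ (Num.truncn (D * c / - x))) := H.
set n := Num.truncn _.
have nx : D * c / - x < n.+1%:R by exact: truncnS_gt.
have n2 : n.+1%:R <= 2 ^+ n :> R by rewrite -natrX ler_nat ltn_expl.
have {nx}n2 := lt_le_trans nx n2.
rewrite ltr_pdivrMr ?oppr_gt0 // in n2.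
rewrite ler_pdivrMr ?exprn_gt0 // => h; move: n2; rewrite ltNge => /negP; apply.
by rewrite mulrN lerNl [_ ^+ _ * _]mulrC.
Qed.

Lemma sub_sigmaI A B : G A -> G B -> G (A `&` B).
Proof.
by move=> /sub_sigma_measurable mA /sub_sigma_measurable mB;
  apply/sub_sigma_measurable; exact: measurableI.
Qed.

Lemma sub_sigmaD A B : G A -> G B -> G (A `\` B).
Proof.
by move=> /sub_sigma_measurable mA /sub_sigma_measurable mB;
  apply/sub_sigma_measurable; exact: measurableD.
Qed.

Lemma sub_sigma_le f g : gmf f -> gmf g -> G [set w | f w <= g w].
Proof.
move=> mf mg; apply/sub_sigma_measurable.
have := measurable_fun_ler mf mg => /(_ measurableT [set true] I).
by rewrite setTI; congr (measurable _); apply/seteqP; split.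
Qed.

Lemma sub_sigma_lt f g : gmf f -> gmf g -> G [set w | f w < g w].
Proof.
move=> mf mg; apply/sub_sigma_measurable.
have := measurable_fun_ltr mf mg => /(_ measurableT [set true] I).
by rewrite setTI; congr (measurable _); apply/seteqP; split.
Qed.

(** An inequality additive in the event need only be checked on pieces where [t] is nearly constant:
    repeated halving of the range of [t] leaves an oscillation of at most [e]. This allows a random
    direction to be frozen. *)
Lemma small_oscillation_ind (Q : set Omega -> Prop) (t : Omega -> R) (e : R) :
  0 < e -> gmf t ->
  (forall A B, G A -> G B -> Q (A `&` B) -> Q (A `\` B) -> Q A) ->
  (forall A, G A -> (forall w w', A w -> A w' -> `|t w - t w'| <= e) -> Q A) ->
  forall A (lo hi : R), G A -> (forall w, A w -> lo <= t w <= hi) -> Q A.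
Proof.
move=> e0 mt QU Qe A lo hi GA tA.
have H n : forall A (lo : R), G A -> (forall w, A w -> lo <= t w <= lo + e * 2 ^+ n) -> Q A.
  elim: n => {A GA tA lo} [|n IH] A lo GA tA.
    apply: Qe => // w w' /tA h /tA h'; move: h h'; rewrite expr0 mulr1 ler_norml.
    by move=> /andP[? ?] /andP[? ?]; apply/andP; split; lra.
  pose B := [set w | t w <= lo + e * 2 ^+ n].
  have GB : G B by exact: sub_sigma_le.
  apply: (QU A B) => //.
    by apply: (IH _ lo); [exact: sub_sigmaI|move=> w [/tA/andP[-> _] ->]].
  apply: (IH _ (lo + e * 2 ^+ n)); first exact: sub_sigmaD.
  move=> w [/tA/andP[_ h] /negP]; rewrite -ltNge => h'; rewrite ltW //=.
  by apply: (le_trans h); rewrite exprS; lra.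
pose n := Num.truncn ((hi - lo) / e).
have nx : (hi - lo) / e < n.+1%:R by exact: truncnS_gt.
have n2 : n.+1%:R <= 2 ^+ n :> R by rewrite -natrX ler_nat ltn_expl.
have {nx n2} := lt_le_trans nx n2; rewrite ltr_pdivrMr // => n2.
apply: (H n A lo) => // w /tA/andP[-> h] /=; rewrite mulrC in n2; lra.
Qed.

End SubSigmaAlgebra.

Lemma pr_split A B : measurable A -> measurable B ->
  pr A = pr (A `&` B) + pr (A `\` B).
Proof.
move=> mA mB; rewrite -prU; [|exact: measurableI|exact: measurableD|].
  by rewrite setUIDK.
by rewrite setDE setIACA setICr setI0.
Qed.

Lemma Ex_split A B f : measurable A -> measurable B -> ebounded f ->
  Ex (fun w => \1_A w * f w) =
  Ex (fun w => \1_(A `&` B) w * f w) + Ex (fun w => \1_(A `\` B) w * f w).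
Proof.
move=> mA mB bf; rewrite -ExD; last 2 first.
- by apply: eboundedM => //; apply: ebounded_indic; exact: measurableI.
- by apply: eboundedM => //; apply: ebounded_indic; exact: measurableD.
congr Ex; apply/funext => w; rewrite -mulrDl; congr (_ * _).
rewrite !indicE in_setD in_setI.
by case: (w \in A); case: (w \in B); rewrite /= ?addr0 ?add0r.
Qed.

End Expectation.

(** * The planar walk: drift and second moments *)

Section PlanarWalk.
Context {disp : measure_display} {Omega : measurableType disp} {R : realType}.
Implicit Types (P : probability Omega R) (F : nat -> set (set Omega))
  (Y : nat -> Omega -> R) (A B : set Omega).

Definition sincr Y n (w : Omega) : R := Y n.+1 w - Y n w.

Definition zero_count (Y1 Y2 : nat -> Omega -> R) k n w : nat :=
  (\sum_(i < n) ((Y1 (k + i)%N w == 0%R) && (Y2 (k + i)%N w == 0%R)))%N.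

(* Conditional expectations and probabilities given F n are encoded by testing
   against the events of F n. *)
Record planar_walk P F (Y1 Y2 : nat -> Omega -> R) (K r h u : R) : Prop := PlanarWalk {
  pw_filtration : is_filtration F;
  pw_meas1 : forall n, measurable_fun (setT : set (g_sigma_algebraType (F n))) (Y1 n);
  pw_meas2 : forall n, measurable_fun (setT : set (g_sigma_algebraType (F n))) (Y2 n);
  pw_jump : forall n,
    {ae P, forall w, sincr Y1 n w ^+ 2 + sincr Y2 n w ^+ 2 <= K ^+ 2};
  pw_driftD : forall n A, F n A ->
    0 <= Ex P (fun w => \1_A w * (sincr Y1 n w + u * sincr Y2 n w));
  pw_driftB : forall n A, F n A ->
    0 <= Ex P (fun w => \1_A w * (sincr Y1 n w - u * sincr Y2 n w));
  pw_elliptic : forall n A (a b : R), a ^+ 2 + b ^+ 2 = 1 -> F n A ->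
    h * pr P A <= pr P (A `&` [set w | r < a * sincr Y1 n w + b * sincr Y2 n w])
}.

Variables (P : probability Omega R) (F : nat -> set (set Omega)).
Variables (Y1 Y2 : nat -> Omega -> R) (K r h u : R).
Hypothesis walk : planar_walk P F Y1 Y2 K r h u.
Hypotheses (K1 : 1 <= K) (r01 : 0 < r <= 1) (h01 : 0 < h <= 1) (u01 : 0 < u <= 1).

Local Notation gmf n := (measurable_fun (setT : set (g_sigma_algebraType (F n)))).

Let K0 : 0 < K. Proof. exact: lt_le_trans K1. Qed.

Lemma filt_sigma n : sigma_algebra setT (F n).
Proof. by have [filt_sigma _ _] := pw_filtration walk. Qed.

Lemma filt_sub n : F n `<=` measurable.
Proof. by have [_ Fm _] := pw_filtration walk; exact: Fm. Qed.

Lemma filtS n A : F n A -> F n.+1 A.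
Proof. by have [_ _ Fl] := pw_filtration walk; exact: Fl. Qed.

Lemma filt_measurableE n A : (F n).-sigma.-measurable A <-> F n A.
Proof. exact: sub_sigma_measurable (filt_sigma n) A. Qed.

Let mY1 n : gmf n (Y1 n). Proof. exact: pw_meas1 walk _. Qed.
Let mY2 n : gmf n (Y2 n). Proof. exact: pw_meas2 walk _. Qed.
Arguments mY1 : clear implicits.
Arguments mY2 : clear implicits.

Lemma filt_measurable_funS n (f : Omega -> R) : gmf n f -> gmf n.+1 f.
Proof. by move=> mf _ B mB; apply/filt_measurableE/filtS/filt_measurableE; exact: mf. Qed.

Lemma filt_measurable_fun n (f : Omega -> R) : gmf n f -> measurable_fun setT f.
Proof. by move=> mf; apply: sub_sigma_measurable_fun mf; [exact: filt_sigma|exact: filt_sub]. Qed.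

Lemma sqr_le_norm (x y : R) : 0 <= y -> x ^+ 2 <= y ^+ 2 -> `|x| <= y.
Proof.
by move=> y0 h2; rewrite -(ger0_norm y0) -ler_sqr ?nnegrE // !real_normK ?num_real.
Qed.

Lemma ae_sincr_le n :
  {ae P, forall w, `|sincr Y1 n w| <= K /\ `|sincr Y2 n w| <= K}.
Proof.
apply: filterS (pw_jump walk n) => w hw; split; apply: (sqr_le_norm (ltW K0)).
  by apply: le_trans hw; rewrite lerDl sqr_ge0.
by apply: le_trans hw; rewrite lerDr sqr_ge0.
Qed.

Lemma ebounded_sincr1 n : ebounded P (sincr Y1 n).
Proof.
split; first by apply: measurable_funB; [exact: (filt_measurable_fun (mY1 n.+1))|exact: (filt_measurable_fun (mY1 n))].
by exists K; apply: filterS (ae_sincr_le n) => w [].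
Qed.

Lemma ebounded_sincr2 n : ebounded P (sincr Y2 n).
Proof.
split; first by apply: measurable_funB; [exact: (filt_measurable_fun (mY2 n.+1))|exact: (filt_measurable_fun (mY2 n))].
by exists K; apply: filterS (ae_sincr_le n) => w [].
Qed.

Let b1 := ebounded_sincr1.
Let b2 := ebounded_sincr2.

Lemma ebounded_restr n A (f : Omega -> R) : F n A -> ebounded P f -> ebounded P (fun w => \1_A w * f w).
Proof. by move=> /filt_sub mA bf; exact: (eboundedM (ebounded_indic P mA) bf). Qed.

Lemma elliptic_second_moment n A (t1 t2 : Omega -> R) :
  gmf n t1 -> gmf n t2 -> (forall w, t1 w ^+ 2 + t2 w ^+ 2 <= 1) ->
  F n A -> (forall w, A w -> t1 w ^+ 2 + t2 w ^+ 2 = 1) ->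
  h * r ^+ 2 / 4 * pr P A <=
  Ex P (fun w => \1_A w * (t1 w * sincr Y1 n w + t2 w * sincr Y2 n w) ^+ 2).
Proof.
move=> mt1 mt2 t1le FA tA.
have [r0 r1] := andP r01; have [h0 h1] := andP h01.
have tb w : `|t1 w| <= 1 /\ `|t2 w| <= 1.
  by split; apply: sqr_le_norm; rewrite // expr1n; apply: le_trans (t1le w);
    rewrite ?lerDl ?lerDr sqr_ge0.
have bt1 : ebounded P t1 by split; [exact: (filt_measurable_fun mt1)|exists 1; apply: aeW => w; have [] := tb w].
have bt2 : ebounded P t2 by split; [exact: (filt_measurable_fun mt2)|exists 1; apply: aeW => w; have [] := tb w].
pose m w := t1 w * sincr Y1 n w + t2 w * sincr Y2 n w.
have bm : ebounded P (fun w => m w ^+ 2).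
  have bm : ebounded P m by apply: eboundedD; exact: eboundedM.
  exact: (eboundedM bm bm).
pose Q B := (forall w, B w -> t1 w ^+ 2 + t2 w ^+ 2 = 1) ->
  h * r ^+ 2 / 4 * pr P B <= Ex P (fun w => \1_B w * m w ^+ 2).
have QU B C : F n B -> F n C -> Q (B `&` C) -> Q (B `\` C) -> Q B.
  move=> /filt_sub mB /filt_sub mC Q1 Q2 tB.
  rewrite (Ex_split mB mC bm) (pr_split P mB mC) mulrDr lerD //.
    by apply: Q1 => w [/tB].
  by apply: Q2 => w [/tB].
pose e := r / (4 * K).
have e0 : 0 < e by rewrite divr_gt0 // mulr_gt0.
have eK : e * K = r / 4 by rewrite /e; field; rewrite gt_eqF.
have itv (t : Omega -> R) : (forall w, `|t w| <= 1) -> forall w, -1 <= t w <= 1.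
  by move=> tw w; rewrite -ler_norml.
apply: (small_oscillation_ind (filt_sigma n) e0 mt1 QU _ FA (fun w _ => itv t1 (fun w => (tb w).1) w) tA).
move=> {}A {}FA osc1 {}tA.
pose Q2 B := (forall w w', B w -> B w' -> `|t1 w - t1 w'| <= e) -> Q B.
have QU2 B C : F n B -> F n C -> Q2 (B `&` C) -> Q2 (B `\` C) -> Q2 B.
  move=> FB FC q1 q2 o; apply: (QU B C) => //.
    by apply: q1 => w w' [Bw _] [Bw' _]; exact: o.
  by apply: q2 => w w' [Bw _] [Bw' _]; exact: o.
apply: (small_oscillation_ind (filt_sigma n) e0 mt2 QU2 _ FA
  (fun w _ => itv t2 (fun w => (tb w).2) w) osc1 tA).
move=> {osc1 tA}A {}FA osc2 osc1 tA.
have [A0|[w0 Aw0]] : A = set0 \/ exists w, A w.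
  have [->|/set0P] := eqVneq A set0; [by left|by right].
  rewrite A0 /pr measure0 mulr0; apply: Ex_ge0.
    by apply: (@ebounded_restr n) => //; rewrite -A0.
  by apply: aeW => w; rewrite mulr_ge0 ?sqr_ge0.
pose E := [set w | r < t1 w0 * sincr Y1 n w + t2 w0 * sincr Y2 n w].
have mE : measurable E.
  have ms1 := (b1 n).1; have ms2 := (b2 n).1.
  have := @measurable_fun_ltr _ _ _ setT (cst r) (fun w => t1 w0 * sincr Y1 n w + t2 w0 * sincr Y2 n w).
  have mm : measurable_fun setT (fun w => t1 w0 * sincr Y1 n w + t2 w0 * sincr Y2 n w).
    by apply: measurable_funD; apply: measurable_funM => //; exact: measurable_cst.
  move=> /(_ (measurable_cst _) mm measurableT [set true] I); rewrite setTI.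
  by congr measurable; apply/seteqP; split.
have mAE : measurable (A `&` E) by apply: measurableI => //; exact: filt_sub FA.
apply: (@le_trans _ _ (r ^+ 2 / 4 * pr P (A `&` E))).
  have -> : h * r ^+ 2 / 4 * pr P A = r ^+ 2 / 4 * (h * pr P A) by ring.
  apply: ler_wpM2l; first by rewrite divr_ge0 ?sqr_ge0.
  exact: (pw_elliptic walk (tA _ Aw0) FA).
rewrite -Ex_indic // -ExZ; last exact: ebounded_indic.
apply: le_Ex; [by apply: eboundedZ; exact: ebounded_indic|exact: (ebounded_restr FA)|].
apply: filterS (ae_sincr_le n) => w [s1 s2].
have m2 : 0 <= m w ^+ 2 := sqr_ge0 _.
have [Aw|Aw] := pselect (A w); last first.
  by rewrite !indicE !memNset ?mulr0 ?mul0r // => -[].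
rewrite [X in _ <= X * _]indicE (mem_set Aw) mul1r.
have [Ew|Ew] := pselect (E w); last first.
  by rewrite indicE memNset ?mulr0 // => -[].
rewrite indicE mem_set // mulr1.
suff : r / 2 <= m w by move=> hm; nra.
have e1 : `|(t1 w0 - t1 w) * sincr Y1 n w| <= e * K.
  by rewrite normrM ler_pM // osc1.
have e2 : `|(t2 w0 - t2 w) * sincr Y2 n w| <= e * K.
  by rewrite normrM ler_pM // osc2.
move: Ew e1 e2; rewrite /E /m /= eK !ler_norml !mulrBl.
lra.
Qed.

Lemma ebounded_on n A (g : Omega -> R) (C : R) : F n A -> gmf n g ->
  (forall w, A w -> 0 <= g w <= C) -> ebounded P (fun w => \1_A w * g w).
Proof.
move=> FA mg gC; split.
  apply: measurable_funM; last exact: (filt_measurable_fun mg).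
  by apply: measurable_indic; exact: filt_sub FA.
exists (Num.max C 0); apply: aeW => w; rewrite indicE.
have [Aw|Aw] := pselect (A w); last by rewrite memNset // mul0r normr0 le_max lexx orbT.
by rewrite mem_set // mul1r; have /andP[g0 gl] := gC w Aw; rewrite ger0_norm // le_max gl.
Qed.

Lemma drift_ge0 n A (g : Omega -> R) (C v : R) : F n A -> gmf n g ->
  (forall w, A w -> 0 <= g w <= C) -> v = u \/ v = - u ->
  0 <= Ex P (fun w => \1_A w * (g w * (sincr Y1 n w + v * sincr Y2 n w))).
Proof.
move=> FA mg gC vu.
have -> : (fun w => \1_A w * (g w * (sincr Y1 n w + v * sincr Y2 n w))) =
  (fun w => (\1_A w * g w) * (sincr Y1 n w + v * sincr Y2 n w)).
  by apply/funext => w; rewrite mulrA.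
apply: (@pull_out_ge0 _ _ _ P (F n) (filt_sigma n) (@filt_sub n) _ _ (Num.max C 0)).
- by apply: eboundedD => //; exact: eboundedZ.
- move=> B FB; case: vu => ->; first exact: (pw_driftD walk).
  have -> : (fun w => \1_B w * (sincr Y1 n w + - u * sincr Y2 n w)) =
            (fun w => \1_B w * (sincr Y1 n w - u * sincr Y2 n w)).
    by apply/funext => w; rewrite mulNr.
  exact: (pw_driftB walk).
- apply: measurable_funM => //; apply: measurable_indic.
  exact: (filt_measurableE _ _).2.
- move=> w; rewrite indicE.
  have [Aw|Aw] := pselect (A w); last by rewrite memNset // mul0r lexx le_max lexx orbT.
  by rewrite mem_set // mul1r; have /andP[-> gl] := gC w Aw; rewrite le_max gl.
Qed.

Lemma ellipticity_ge0 n A (g t1 t2 : Omega -> R) (C : R) : F n A -> gmf n g ->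
  (forall w, A w -> 0 <= g w <= C) ->
  gmf n t1 -> gmf n t2 -> (forall w, t1 w ^+ 2 + t2 w ^+ 2 <= 1) ->
  (forall w, A w -> t1 w ^+ 2 + t2 w ^+ 2 = 1) ->
  0 <= Ex P (fun w => \1_A w * (g w *
    ((t1 w * sincr Y1 n w + t2 w * sincr Y2 n w) ^+ 2 - h * r ^+ 2 / 4))).
Proof.
move=> FA mg gC mt1 mt2 tle tA; pose m w := (t1 w * sincr Y1 n w + t2 w * sincr Y2 n w) ^+ 2.
have bm : ebounded P m.
  have tb w : `|t1 w| <= 1 /\ `|t2 w| <= 1.
    by split; apply: sqr_le_norm; rewrite // expr1n; apply: le_trans (tle w);
      rewrite ?lerDl ?lerDr sqr_ge0.
  have bt1 : ebounded P t1.
    by split; [exact: (filt_measurable_fun mt1)|exists 1; apply: aeW => w; have [] := tb w].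
  have bt2 : ebounded P t2.
    by split; [exact: (filt_measurable_fun mt2)|exists 1; apply: aeW => w; have [] := tb w].
  by apply: eboundedM; apply: eboundedD; exact: eboundedM.
pose c := h * r ^+ 2 / 4.
have bmc : ebounded P (fun w => m w - c) by apply: eboundedB => //; exact: ebounded_cst.
change (0 <= Ex P (fun w => \1_A w * (g w * (m w - c)))).
(* The indicator is doubled since (t1, t2) is a unit vector only on [A]: the second copy makes the
   tested expectation nonnegative for every event of [F n]. *)
have -> : (fun w => \1_A w * (g w * (m w - c))) =
    (fun w => (\1_A w * g w) * (\1_A w * (m w - c))).
  apply/funext => w; rewrite indicE.
  by case: (w \in A); rewrite ?mul1r // !mul0r.
apply: (@pull_out_ge0 _ _ _ P (F n) (filt_sigma n) (@filt_sub n) _ _ (Num.max C 0)).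
- exact: (ebounded_restr FA).
- move=> B FB; have FBA : F n (B `&` A) by exact: (sub_sigmaI (filt_sigma n)).
  have -> : (fun w => \1_B w * (\1_A w * (m w - c))) =
            (fun w => \1_(B `&` A) w * m w - c * \1_(B `&` A) w).
    apply/funext => w; rewrite !indicE in_setI.
    by case: (w \in B); case: (w \in A); rewrite /= ?(mul1r, mul0r, mulr0, mulr1, subr0).
  have b : ebounded P (\1_(B `&` A)) by apply: ebounded_indic; exact: filt_sub FBA.
  rewrite ExB; [|exact: (ebounded_restr FBA)|exact: eboundedZ].
  rewrite ExZ // Ex_indic; last exact: filt_sub FBA.
  rewrite subr_ge0; apply: (elliptic_second_moment mt1 mt2 tle FBA).
  by move=> w [_ /tA].
- apply: measurable_funM => //; apply: measurable_indic.
  exact: (filt_measurableE _ _).2.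
- move=> w; rewrite indicE.
  have [Aw|Aw] := pselect (A w); last by rewrite memNset // mul0r lexx le_max lexx orbT.
  by rewrite mem_set // mul1r; have /andP[-> gl] := gC w Aw; rewrite le_max gl.
Qed.

(** * Zeros of the walk, and avoiding them from far away *)

Local Notation zeros := (zero_count Y1 Y2).
Definition zero_at k : set Omega := [set w | Y1 k w = 0 /\ Y2 k w = 0].
Definition many_zeros k n j : set Omega := [set w | (j <= zeros k n w)%N].

Lemma zerosS k n w : zeros k n.+1 w =
  (((Y1 k w == 0%R) && (Y2 k w == 0%R)) + zeros k.+1 n w)%N.
Proof.
rewrite /zero_count big_ord_recl addn0; congr addn.
by apply: eq_bigr => i _; rewrite /= /bump /= add1n addnS addSn.
Qed.

Lemma zerosS_zero k n w : zero_at k w -> zeros k n.+1 w = (zeros k.+1 n w).+1.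
Proof. by move=> [z1 z2]; rewrite zerosS z1 z2 eqxx. Qed.

Lemma zerosS_nonzero k n w : ~ zero_at k w -> zeros k n.+1 w = zeros k.+1 n w.
Proof.
by move=> nz; rewrite zerosS; case: eqP => // z1; case: eqP => // z2; case: nz.
Qed.

Lemma zero_at_filt k : F k (zero_at k).
Proof.
have m0 : gmf k (cst 0 : Omega -> R) by exact: measurable_cst.
have -> : zero_at k = [set w | Y1 k w <= cst 0 w] `&` [set w | cst 0 w <= Y1 k w]
   `&` ([set w | Y2 k w <= cst 0 w] `&` [set w | cst 0 w <= Y2 k w]).
  apply/seteqP; split=> w /= => [[-> ->]|[[l1 l2] [l3 l4]]]; first by rewrite !lexx.
  by split; apply/eqP; rewrite eq_le ?l1 ?l2 ?l3 ?l4.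
have sk := filt_sigma k.
by apply: (sub_sigmaI sk); apply: (sub_sigmaI sk); apply: (sub_sigma_le sk).
Qed.

Lemma measurable_many_zeros k n j : measurable (many_zeros k n j).
Proof.
elim: n k j => [|n IH] k [|j].
- by have -> : many_zeros k 0 0 = setT by apply/seteqP; split.
- have -> : many_zeros k 0 j.+1 = set0; last exact: measurable0.
  by apply/seteqP; split=> // w; rewrite /many_zeros /= /zero_count big_ord0.
- by have -> : many_zeros k n.+1 0 = setT by apply/seteqP; split.
have mz : measurable (zero_at k) by exact: filt_sub (zero_at_filt k).
have -> : many_zeros k n.+1 j.+1 = (zero_at k `&` many_zeros k.+1 n j) `|`
    (many_zeros k.+1 n j.+1 `\` zero_at k).
  apply/seteqP; split=> w; rewrite /many_zeros /=.
    have [z|z] := pselect (zero_at k w); first by rewrite zerosS_zero //; left.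
    by rewrite zerosS_nonzero //; right.
  by move=> [[z]|[+ z]]; [rewrite zerosS_zero|rewrite zerosS_nonzero].
by apply: measurableU; [apply: measurableI|apply: measurableD].
Qed.

(* Chebyshev's inequality for the squared shortfall of the submartingale
   Y1 + v Y2 below the level N, by induction on the length of the window. *)
Lemma hitting_bound (v N : R) : v = u \/ v = - u -> 0 < N ->
  forall n k A, F k A ->
  N ^+ 2 * pr P (A `&` many_zeros k n 1) <=
  Ex P (fun w => \1_A w * Num.max (N - Num.max (Y1 k w + v * Y2 k w) 0) 0 ^+ 2)
  + n%:R * (4 * K ^+ 2) * pr P A.
Proof.
move=> vu N0; set psi := fun z : R => Num.max (N - Num.max z 0) 0 ^+ 2.
pose Z k w := Y1 k w + v * Y2 k w.
have mZ k : gmf k (Z k).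
  by apply: measurable_funD => //; apply: measurable_funM => //; exact: measurable_cst.
pose bZ k w := Num.max (N - Num.max (Z k w) 0) 0.
have mbZ k : gmf k (bZ k).
  apply: measurable_maxr; last exact: measurable_cst.
  apply: measurable_funB; first exact: measurable_cst.
  by apply: measurable_maxr => //; exact: measurable_cst.
have bZN k w : 0 <= bZ k w <= N.
  rewrite /bZ le_max lexx orbT /= ge_max (ltW N0) andbT gerBl.
  by rewrite le_max lexx orbT.
have bpsi k : ebounded P (fun w => psi (Z k w)).
  have bb : ebounded P (bZ k).
    split; first exact: (filt_measurable_fun (mbZ k)).
    by exists N; apply: aeW => w; have /andP[z0 zN] := bZN k w; rewrite ger0_norm.
  exact: (eboundedM bb bb).
have psi_ge0 z : 0 <= psi z by exact: sqr_ge0.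
suff H n : forall k A, F k A -> N ^+ 2 * pr P (A `&` many_zeros k n 1) <=
    Ex P (fun w => \1_A w * psi (Z k w)) + n%:R * (4 * K ^+ 2) * pr P A by [].
elim: n => [|n IH] k A FA.
  have -> : A `&` many_zeros k 0 1 = set0.
    by apply/seteqP; split=> // w [_]; rewrite /many_zeros /= /zero_count big_ord0.
  rewrite /pr measure0 /= mulr0 !mul0r addr0.
  apply: Ex_ge0; first exact: (ebounded_restr FA (bpsi k)).
  by apply: aeW => w; rewrite mulr_ge0.
have mA := filt_sub FA.
(* Where Z <= 0 the shortfall is already [N] and the bound is trivial. Elsewhere the walk is not at
   0, so the window may start one step later, at the cost (2 K)^2 of one increment. *)
pose B := [set w | Z k w <= cst 0 w].
have FB : F k B.
  by apply: (sub_sigma_le (filt_sigma k)) => //; exact: measurable_cst.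
have mB := filt_sub FB.
have FAB : F k (A `&` B) by exact: (sub_sigmaI (filt_sigma k)).
have FAB' : F k (A `\` B) by exact: (sub_sigmaD (filt_sigma k)).
have mmz := measurable_many_zeros k n.+1 1.
rewrite (pr_split P (measurableI _ _ mA mmz) mB) mulrDr.
have K2 : 0 <= 4 * K ^+ 2 by rewrite mulr_ge0 // sqr_ge0.
rewrite (Ex_split mA mB (bpsi k)) (pr_split P mA mB) mulrDr addrACA.
apply: lerD.
  apply: (@le_trans _ _ (N ^+ 2 * pr P (A `&` B))).
    rewrite ler_pM2l ?exprn_gt0 //; apply: le_pr; [|exact: measurableI|].
      by apply: measurableI => //; exact: measurableI.
    by move=> w [[]].
  rewrite -[leLHS]addr0; apply: lerD; last by rewrite mulr_ge0 ?pr_ge0 // mulr_ge0.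
  rewrite -Ex_indic; last exact: filt_sub FAB.
  rewrite -ExZ; last by apply: ebounded_indic; exact: filt_sub FAB.
  apply: le_Ex; [by apply: eboundedZ; apply: ebounded_indic; exact: filt_sub FAB
    |exact: (ebounded_restr FAB)|].
  apply: aeW => w; rewrite indicE.
  have [ABw|ABw] := pselect ((A `&` B) w); last by rewrite memNset // mulr0 mul0r.
  rewrite mem_set // mulr1 mul1r /psi; have [_ Zw] := ABw.
  by rewrite (max_r Zw) subr0 (max_l (ltW N0)).
have -> : (A `&` many_zeros k n.+1 1) `\` B = (A `\` B) `&` many_zeros k.+1 n 1.
  apply/seteqP; split=> w.
    move=> [[Aw mz] Bw]; split=> //; move: mz; rewrite /many_zeros /= zerosS_nonzero //.
    by move=> [z1 z2]; apply: Bw; rewrite /B /Z /= z1 z2 mulr0 addr0.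
  move=> [[Aw Bw]] mz; split=> //; split=> //; move: mz; rewrite /many_zeros /= zerosS_nonzero //.
  by move=> [z1 z2]; apply: Bw; rewrite /B /Z /= z1 z2 mulr0 addr0.
apply: (le_trans (IH k.+1 _ (filtS FAB'))).
suff key : Ex P (fun w => \1_(A `\` B) w * psi (Z k.+1 w)) <=
    Ex P (fun w => \1_(A `\` B) w * psi (Z k w)) + 4 * K ^+ 2 * pr P (A `\` B).
  by rewrite -[n.+1]addn1 natrD; move: key; lra.
pose g w := 2 * bZ k w.
have b12 : ebounded P (fun w => sincr Y1 k w + v * sincr Y2 k w).
  by apply: eboundedD => //; exact: eboundedZ.
have mg : gmf k g by apply: measurable_funM => //; exact: measurable_cst.
have gb w : 0 <= g w <= 2 * N.
  by have /andP[z0 zN] := bZN k w; rewrite mulr_ge0 //= ler_pM2l.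
have bg : ebounded P g.
  split; first exact: (filt_measurable_fun mg).
  by exists (2 * N); apply: aeW => w; have /andP[? ?] := gb w; rewrite ger0_norm.
have d0 := drift_ge0 FAB' mg (fun w _ => gb w) vu.
have b1A : ebounded P (fun w => 4 * K ^+ 2 * \1_(A `\` B) w).
  by apply: eboundedZ; apply: ebounded_indic; exact: filt_sub FAB'.
have b2A := ebounded_restr FAB' (bpsi k).
have b3A := ebounded_restr FAB' (eboundedM bg b12).
apply: (@le_trans _ _ (Ex P (fun w => \1_(A `\` B) w * psi (Z k w) +
  4 * K ^+ 2 * \1_(A `\` B) w - \1_(A `\` B) w * (g w * (sincr Y1 k w + v * sincr Y2 k w))))).
  apply: le_Ex; [exact: (ebounded_restr FAB')|by apply: eboundedB => //; exact: eboundedD|].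
  apply: filterS (ae_sincr_le k) => w [s1 s2]; rewrite indicE.
  have [ABw|ABw] := pselect ((A `\` B) w); last by rewrite memNset // !mul0r mulr0 addr0 subr0.
  rewrite mem_set // !mul1r mulr1.
  have Z0 : 0 < Z k w by rewrite ltNge; apply/negP => hZ; case: ABw => _; apply.
  have := @escape_cost_step R N (Z k w) (sincr Y1 k w + v * sincr Y2 k w) Z0.
  have -> : Z k w + (sincr Y1 k w + v * sincr Y2 k w) = Z k.+1 w.
    by rewrite /Z /sincr; ring.
  move=> /le_trans; apply; rewrite -/(psi _) /g -/(bZ k w).
  suff : (sincr Y1 k w + v * sincr Y2 k w) ^+ 2 <= 4 * K ^+ 2.
    by move: (psi _) (sincr Y1 k w + _) => x y; lra.
  have dz : `|sincr Y1 k w + v * sincr Y2 k w| <= 2 * K.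
    apply: (le_trans (ler_normD _ _)); rewrite normrM.
    have v1 : `|v| <= 1.
      by have /andP[u0 u1] := u01; case: vu => ->; rewrite ?normrN gtr0_norm.
    have : `|v| * `|sincr Y2 k w| <= 1 * K by rewrite ler_pM.
    by move: s1 => s1 s3; lra.
  have -> : 4 * K ^+ 2 = (2 * K) ^+ 2 by ring.
  rewrite -[leLHS]real_normK ?num_real // ler_pXn2r ?nnegrE //.
  by rewrite mulr_ge0 // ltW.
rewrite ExB //; last exact: eboundedD.
rewrite ExD // ExZ; last by apply: ebounded_indic; exact: filt_sub FAB'.
rewrite Ex_indic; last exact: filt_sub FAB'.
by rewrite gerBl.
Qed.

(** The initial shortfall vanishes, so N^2 times the probability of a zero is at most 4 n K^2 <= N^2
    / 2 times that of [A]. *)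
Lemma avoid_zero_far (v N : R) n k A : v = u \/ v = - u -> 0 < N -> F k A ->
  (forall w, A w -> N <= Y1 k w + v * Y2 k w) -> 8 * n%:R * K ^+ 2 <= N ^+ 2 ->
  1 / 2 * pr P A <= pr P (A `\` many_zeros k n 1).
Proof.
move=> vu N0 FA AN nN; have mA := filt_sub FA.
have mm := measurable_many_zeros k n 1.
have := hitting_bound vu N0 n FA.
have -> : (fun w => \1_A w * Num.max (N - Num.max (Y1 k w + v * Y2 k w) 0) 0 ^+ 2) = cst 0.
  apply/funext => w; rewrite indicE /=.
  have [Aw|Aw] := pselect (A w); last by rewrite memNset // mul0r.
  rewrite mem_set // mul1r max_r ?expr0n // subr_le0 le_max.
  by rewrite AN.
have -> : Ex P (cst 0) = 0 by rewrite /Ex Rintegral_cst // mul0r.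
rewrite add0r (pr_split P mA mm).
set p1 := pr P (A `&` _); set p2 := pr P (A `\` _) => hit.
have p10 : 0 <= p1 by exact: pr_ge0.
have p20 : 0 <= p2 by exact: pr_ge0.
have : N ^+ 2 * p1 <= N ^+ 2 * (1 / 2 * (p1 + p2)).
  apply: (le_trans hit).
  have : 8 * n%:R * K ^+ 2 * (p1 + p2) <= N ^+ 2 * (p1 + p2) by rewrite ler_wpM2r // addr_ge0.
  lra.
rewrite ler_pM2l ?exprn_gt0 // => *; lra.
Qed.

(** * Measurability of the Lyapunov function and of its weights *)

Let sqnorm k w := Y1 k w ^+ 2 + Y2 k w ^+ 2.

Let m_sqnorm k : gmf k (sqnorm k).
Proof. by apply: measurable_funD; exact: measurable_funX. Qed.
Arguments m_sqnorm : clear implicits.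

Let m_norm k : gmf k (fun w => Num.sqrt (sqnorm k w)).
Proof.
apply: measurableT_comp; last exact: m_sqnorm.
by apply: continuous_measurable_fun; exact: sqrt_continuous.
Qed.
Arguments m_norm : clear implicits.

Let m_normV k : gmf k (fun w => (Num.sqrt (sqnorm k w))^-1).
Proof.
have -> : (fun w => (Num.sqrt (sqnorm k w))^-1) = (fun w => (Num.sqrt (sqnorm k w)) `^ (-1)).
  by apply/funext => w; rewrite powR_inv1 ?sqrtr_ge0.
exact: (measurableT_comp (measurable_powR (-1)) (m_norm k)).
Qed.
Arguments m_normV : clear implicits.

Let m_lyapunov k s a : gmf k (fun w => lyapunov s a (Y1 k w) (Y2 k w)).
Proof.
apply: measurable_funM.
  apply: measurable_funD => //; apply: measurable_funM; first exact: measurable_cst.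
  exact: m_norm.
exact: (measurableT_comp (measurable_powR (- a)) (m_sqnorm k)).
Qed.
Arguments m_lyapunov : clear implicits.

Let m_slope k a : gmf k (fun w => radial_slope u a (Y1 k w) (Y2 k w)).
Proof.
apply: measurable_funB; first exact: measurable_cst.
apply: measurable_funM; first exact: measurable_cst.
apply: measurable_funM; last exact: m_normV.
apply: measurable_funD => //; apply: measurable_funM; first exact: measurable_cst.
exact: m_norm.
Qed.
Arguments m_slope : clear implicits.

Let m_push k a v : gmf k (fun w => push_weight u a v (Y1 k w) (Y2 k w)).
Proof.
apply: measurable_funM.
  exact: (measurableT_comp (measurable_powR (- a)) (m_sqnorm k)).
apply: measurable_funM; last exact: measurable_cst.
apply: measurable_funD.
  apply: measurable_funD; first exact: measurable_cst.
  apply: measurable_funM; first exact: m_slope.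
  by apply: measurable_funM => //; exact: m_normV.
apply: measurable_funM; last exact: measurable_cst.
apply: measurable_funM; first exact: m_slope.
by apply: measurable_funM => //; exact: m_normV.
Qed.
Arguments m_push : clear implicits.

Let m_curvature k a : gmf k (fun w => curvature_weight u a (Y1 k w) (Y2 k w)).
Proof.
apply: measurable_funM.
  exact: (measurableT_comp (measurable_powR (- a)) (m_sqnorm k)).
apply: measurable_funM; first exact: measurable_cst.
have -> : (fun w => (4 * Num.sqrt (Y1 k w ^+ 2 + Y2 k w ^+ 2))^-1) =
  (fun w => 4^-1 * (Num.sqrt (sqnorm k w))^-1).
  by apply/funext => w; rewrite invfM.
by apply: measurable_funM; [exact: measurable_cst|exact: m_normV].
Qed.
Arguments m_curvature : clear implicits.

Lemma ebounded_weighted n A (g f : Omega -> R) (C : R) : F n A -> gmf n g ->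
  (forall w, A w -> 0 <= g w <= C) -> ebounded P f ->
  ebounded P (fun w => \1_A w * (g w * f w)).
Proof.
move=> FA mg gC bf.
have -> : (fun w => \1_A w * (g w * f w)) = (fun w => (\1_A w * g w) * f w).
  by apply/funext => w; rewrite mulrA.
by apply: eboundedM => //; exact: (ebounded_on FA mg gC).
Qed.

(** * Escape from the origin *)

Section Escape.
Variables (a b B N : R) (n : nat).
Hypotheses (a0 : 0 < a) (a_small : 1856 * a * K ^+ 2 <= u * (h * r ^+ 2 / 4)).
Hypotheses (b0 : 0 <= b) (B0 : 0 < B) (N0 : 0 < N).
Hypothesis lyap_in : forall y1 y2 : R, y1 ^+ 2 + y2 ^+ 2 < (8 * K) ^+ 2 ->
  lyapunov (u / 4) a y1 y2 <= b.
Hypothesis lyap_out : forall y1 y2 : R, y1 ^+ 2 + y2 ^+ 2 <= (N + K) ^+ 2 ->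
  lyapunov (u / 4) a y1 y2 <= B / 2.
Hypothesis N_large : 8 * n%:R * K ^+ 2 <= (u / 2 * N) ^+ 2.

Let L k w := lyapunov (u / 4) a (Y1 k w) (Y2 k w).
Let near_ball k : set Omega := [set w | sqnorm k w <= (N + K) ^+ 2].

(* Vanishes near the origin and outside the ball of radius N + K; in between it
   bounds from below, up to a constant, the probability of escaping. *)
Definition escape_potential k w : R :=
  \1_(near_ball k) w * Num.max ((L k w - b) / B) 0.

Lemma escape_potentialE k w : near_ball k w ->
  escape_potential k w = Num.max ((L k w - b) / B) 0.
Proof. by move=> bw; rewrite /escape_potential indicE mem_set // mul1r. Qed.

Lemma escape_potential_bounds k w : 0 <= escape_potential k w <= 1 / 2.
Proof.
have [bw|bw] := pselect (near_ball k w); last first.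
  by rewrite /escape_potential indicE memNset // mul0r lexx /=.
rewrite escape_potentialE // le_max lexx orbT /= ge_max; apply/andP; split=> //.
rewrite ler_pdivrMr // lerBlDr mul1r mulrC.
by apply: (le_trans (lyap_out bw)); rewrite lerDl.
Qed.

Lemma escape_potential_out k w :
  ~ (b < L k w /\ near_ball k w) -> escape_potential k w = 0.
Proof.
move=> nw; have [bw|bw] := pselect (near_ball k w); last first.
  by rewrite /escape_potential indicE memNset // mul0r.
rewrite escape_potentialE // max_r //.
rewrite pmulr_lle0 ?invr_gt0 // subr_le0 leNgt; apply/negP => Lb.
by apply: nw.
Qed.

Let F_near k : F k (near_ball k).
Proof.
apply: (sub_sigma_le (filt_sigma k)); first exact: m_sqnorm.
exact: measurable_cst.
Qed.

Let m_potential k : gmf k (escape_potential k).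
Proof.
apply: measurable_funM.
  by apply: measurable_indic; apply: (filt_measurableE _ _).2; exact: F_near.
apply: measurable_maxr; last exact: measurable_cst.
apply: measurable_funM; last exact: measurable_cst.
apply: measurable_funB; last exact: measurable_cst.
exact: m_lyapunov.
Qed.
Arguments m_potential : clear implicits.

Lemma ebounded_potential k : ebounded P (escape_potential k).
Proof.
split; first exact: (filt_measurable_fun (m_potential k)).
exists (1 / 2); apply: aeW => w; have /andP[p0 p1] := escape_potential_bounds k w.
by rewrite ger0_norm.
Qed.

(** On this annulus the truncations are harmless. At time [k] the maximum is (L - b) / B because L >
    b; at time k + 1 that expression is a lower bound; and one jump from inside radius [N] stays
    within N + K, so both indicators are 1. What remains is the Lyapunov step, whose three
    correction terms have nonnegative expectation. *)
Lemma escape_potential_step k A : F k A ->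
  (forall w, A w -> (8 * K) ^+ 2 <= sqnorm k w < N ^+ 2 /\ b < L k w) ->
  Ex P (fun w => \1_A w * escape_potential k w) <=
  Ex P (fun w => \1_A w * escape_potential k.+1 w).
Proof.
move=> FA HA; have mA := filt_sub FA.
have [r0 r1] := andP r01; have [h0 h1] := andP h01; have [u0 u1] := andP u01.
have cK : h * r ^+ 2 / 4 <= K ^+ 2.
  have K2 : 1 <= K ^+ 2 by rewrite expr_ge1 // ltW.
  have r2 : r ^+ 2 <= 1 by rewrite expr_le1 // ltW.
  have : h * r ^+ 2 <= 1 * 1 by apply: ler_pM => //; [exact: ltW|exact: sqr_ge0].
  lra.
pose g1 w := push_weight u a u (Y1 k w) (Y2 k w).
pose g2 w := push_weight u a (- u) (Y1 k w) (Y2 k w).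
pose g3 w := curvature_weight u a (Y1 k w) (Y2 k w).
pose x w := Num.sqrt (sqnorm k w).
(* Tangential unit vector. Division by zero makes it 0 at the origin, so its norm is at most 1
   everywhere, and 1 on [A]. *)
pose t1 w := - (Y2 k w / x w); pose t2 w := Y1 k w / x w.
have tE w : t1 w ^+ 2 + t2 w ^+ 2 = sqnorm k w / sqnorm k w.
  rewrite /t1 /t2 sqrrN !expr_div_n -mulrDl addrC /x sqr_sqrtr //.
  by rewrite addr_ge0 ?sqr_ge0.
have tle w : t1 w ^+ 2 + t2 w ^+ 2 <= 1.
  rewrite tE; have [->|q0] := eqVneq (sqnorm k w) 0; first by rewrite mul0r.
  by rewrite divff.
have qA w : A w -> 0 < sqnorm k w.
  move=> /HA[/andP[q1 _] _]; apply: lt_le_trans q1.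
  by rewrite exprn_gt0 // mulr_gt0.
have tA w : A w -> t1 w ^+ 2 + t2 w ^+ 2 = 1.
  by move=> /qA q0; rewrite tE divff // gt_eqF.
have mt2 : gmf k t2 by apply: measurable_funM => //; exact: m_normV.
have mt1 : gmf k t1.
  have -> : t1 = (fun w => -1 * (Y2 k w * (x w)^-1)) by apply/funext => w; rewrite mulN1r.
  apply: measurable_funM; first exact: measurable_cst.
  by apply: measurable_funM => //; exact: m_normV.
have W w : A w -> [/\ 0 <= g1 w <= 1, 0 <= g2 w <= 1 & 0 <= g3 w <= 1].
  move=> Aw; have [/andP[q1 _] _] := HA w Aw.
  have z : (0 : R) ^+ 2 + 0 ^+ 2 <= K ^+ 2 by rewrite expr0n /= addr0 sqr_ge0.
  by have [] := lyapunov_step_weights K1 cK u01 a0 a_small q1 z.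
have W1 w : A w -> 0 <= g1 w <= 1 by move=> /W[].
have W2 w : A w -> 0 <= g2 w <= 1 by move=> /W[].
have W3 w : A w -> 0 <= g3 w <= 1 by move=> /W[].
pose f1 w := sincr Y1 k w + u * sincr Y2 k w.
pose f2 w := sincr Y1 k w + - u * sincr Y2 k w.
pose f3 w := (t1 w * sincr Y1 k w + t2 w * sincr Y2 k w) ^+ 2 - h * r ^+ 2 / 4.
have bf1 : ebounded P f1 by apply: eboundedD => //; exact: eboundedZ.
have bf2 : ebounded P f2 by apply: eboundedD => //; exact: eboundedZ.
have bf3 : ebounded P f3.
  have tb w : `|t1 w| <= 1 /\ `|t2 w| <= 1.
    by split; apply: sqr_le_norm; rewrite // expr1n; apply: le_trans (tle w);
      rewrite ?lerDl ?lerDr sqr_ge0.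
  have bt1 : ebounded P t1.
    by split; [exact: (filt_measurable_fun mt1)|exists 1; apply: aeW => w; have [] := tb w].
  have bt2 : ebounded P t2.
    by split; [exact: (filt_measurable_fun mt2)|exists 1; apply: aeW => w; have [] := tb w].
  apply: eboundedB; last exact: ebounded_cst.
  by apply: eboundedM; apply: eboundedD; exact: eboundedM.
have mg1 : gmf k g1 by exact: m_push.
have mg2 : gmf k g2 by exact: m_push.
have mg3 : gmf k g3 by exact: m_curvature.
have d1 := drift_ge0 FA mg1 W1 (or_introl erefl).
have d2 := drift_ge0 FA mg2 W2 (or_intror erefl).
have d3 := ellipticity_ge0 FA mg3 W3 mt1 mt2 tle tA.
have e1 := ebounded_weighted FA mg1 W1 bf1.
have e2 := ebounded_weighted FA mg2 W2 bf2.
have e3 := ebounded_weighted FA mg3 W3 bf3.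
have ep := ebounded_restr FA (ebounded_potential k).
have ep' := ebounded_restr FA (ebounded_potential k.+1).
pose S w := \1_A w * (g1 w * f1 w) + \1_A w * (g2 w * f2 w) + \1_A w * (g3 w * f3 w).
have bS : ebounded P S by apply: eboundedD => //; exact: eboundedD.
have S0 : 0 <= Ex P S.
  by rewrite /S ExD //; [rewrite ExD // !addr_ge0|exact: eboundedD].
apply: (@le_trans _ _ (Ex P (fun w => \1_A w * escape_potential k w + B^-1 * S w))).
  rewrite ExD //; last exact: eboundedZ.
  by rewrite ExZ // lerDl mulr_ge0 // invr_ge0 ltW.
apply: le_Ex => //; first by apply: eboundedD => //; exact: eboundedZ.
apply: filterS (pw_jump walk k) => w jump; rewrite /S indicE.
have [Aw|Aw] := pselect (A w); last by rewrite memNset // !mul0r !addr0 mulr0.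
rewrite mem_set // !mul1r; have [/andP[q1 q2] Lb] := HA w Aw.
have [_ _ _ step] := lyapunov_step_weights K1 cK u01 a0 a_small q1 jump.
have Y1E : Y1 k w + sincr Y1 k w = Y1 k.+1 w by rewrite /sincr addrC subrK.
have Y2E : Y2 k w + sincr Y2 k w = Y2 k.+1 w by rewrite /sincr addrC subrK.
rewrite Y1E Y2E -/(sqnorm k w) in step.
have bk : near_ball k w.
  rewrite /near_ball /=; apply: ltW; apply: (lt_trans q2).
  by rewrite ltrXn2r ?nnegrE ?addr_ge0 ?ltW // ltrDl.
have bk1 : near_ball k.+1 w.
  rewrite /near_ball /= /sqnorm -Y1E -Y2E.
  exact: (sqr_norm_triangle (ltW N0) (ltW K0) (ltW q2) jump).
rewrite (escape_potentialE bk) (escape_potentialE bk1) max_l; last first.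
  by rewrite divr_ge0 // ?ltW // subr_gt0.
apply: (@le_trans _ _ ((L k.+1 w - b) / B)); last by rewrite le_max lexx.
rewrite [_^-1 * _]mulrC -mulrDl ler_pM2r ?invr_gt0 //.
rewrite addrAC lerD2r; exact: step.
Qed.

(** Optional stopping as a backward induction. Where L <= b or beyond radius N + K the potential is
    0. From radius [N] on it is at most 1/2, and one of Y1 + u Y2 and Y1 - u Y2 is large enough for
    [avoid_zero_far]. On the remaining annulus the potential grows in mean and the walk is not at 0
    at time [k]. *)
Lemma avoid_zero_potential n' k A : (n' <= n)%N -> F k A ->
  Ex P (fun w => \1_A w * escape_potential k w) <=
  pr P (A `\` many_zeros k n' 1).
Proof.
elim: n' k A => [|n' IH] k A n'n FA; have mA := filt_sub FA.
  have -> : A `\` many_zeros k 0 1 = A.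
    by apply/seteqP; split=> [w []//|w Aw]; split=> //; rewrite /many_zeros /= /zero_count big_ord0.
  rewrite -Ex_indic //; apply: le_Ex.
  - exact: (ebounded_restr FA (ebounded_potential k)).
  - exact: ebounded_indic.
  apply: aeW => w; have /andP[p0 p1] := escape_potential_bounds k w.
  rewrite -[leRHS]mulr1 ler_wpM2l // ?indicE //.
  by apply: (le_trans p1); lra.
have u0 : 0 < u by have /andP[] := u01.
have N2 : 0 < u / 2 * N by rewrite mulr_gt0 // divr_gt0.
have sk := filt_sigma k.
have mm := measurable_many_zeros k n'.+1 1.
have bp := ebounded_potential k.
have far v D : v = u \/ v = - u -> F k D -> (forall w, D w -> u / 2 * N <= Y1 k w + v * Y2 k w) ->
    Ex P (fun w => \1_D w * escape_potential k w) <= pr P (D `\` many_zeros k n'.+1 1).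
  move=> vu FD HD; have mD := filt_sub FD.
  have nN : 8 * n'.+1%:R * K ^+ 2 <= (u / 2 * N) ^+ 2.
    apply: le_trans N_large; rewrite ler_wpM2r ?sqr_ge0 // ler_pM2l //.
    by rewrite ler_nat.
  apply: le_trans (avoid_zero_far vu N2 FD HD nN).
  rewrite -Ex_indic // -ExZ; last exact: ebounded_indic.
  apply: le_Ex; [exact: (ebounded_restr FD bp)|by apply: eboundedZ; exact: ebounded_indic|].
  apply: aeW => w; have /andP[p0 p1] := escape_potential_bounds k w.
  by rewrite mulrC ler_wpM2r // indicE.
have splitting B' D : F k B' -> F k D ->
    Ex P (fun w => \1_(B' `&` D) w * escape_potential k w) <=
       pr P ((B' `&` D) `\` many_zeros k n'.+1 1) ->
    Ex P (fun w => \1_(B' `\` D) w * escape_potential k w) <=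
       pr P ((B' `\` D) `\` many_zeros k n'.+1 1) ->
    Ex P (fun w => \1_B' w * escape_potential k w) <=
       pr P (B' `\` many_zeros k n'.+1 1).
  move=> FB' FD i1 i2; have mB' := filt_sub FB'; have mD := filt_sub FD.
  rewrite (Ex_split mB' mD bp) (pr_split P (measurableD mB' mm) mD).
  have -> : (B' `\` many_zeros k n'.+1 1) `&` D = B' `&` D `\` many_zeros k n'.+1 1.
    by rewrite !setDE setIAC.
  have -> : B' `\` many_zeros k n'.+1 1 `\` D = B' `\` D `\` many_zeros k n'.+1 1.
    by rewrite !setDE setIAC.
  exact: lerD.
have mL : gmf k (L k) by exact: m_lyapunov.
pose C := [set w | b < L k w] `&` near_ball k.
have FC : F k C.
  by apply: (sub_sigmaI sk) (F_near k); apply: (sub_sigma_lt sk) => //; exact: measurable_cst.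
apply: (splitting A C) => //; last first.
  have -> : (fun w => \1_(A `\` C) w * escape_potential k w) = cst 0.
    apply/funext => w; rewrite indicE /=.
    have [Aw|Aw] := pselect ((A `\` C) w); last by rewrite memNset // mul0r.
    by rewrite escape_potential_out ?mulr0 // => -[Lb nb]; case: Aw => _; apply.
  by rewrite /Ex Rintegral_cst // mul0r pr_ge0.
have FAC : F k (A `&` C) by exact: (sub_sigmaI sk).
pose D := [set w | N ^+ 2 <= sqnorm k w].
have FD : F k D by apply: (sub_sigma_le sk) => //; exact: measurable_cst.
apply: (splitting _ D) => //.
  have FACD : F k (A `&` C `&` D) by exact: (sub_sigmaI sk).
  pose E := [set w | u / 2 * N <= Y1 k w + u * Y2 k w].
  have FE : F k E.
    apply: (sub_sigma_le sk); first exact: measurable_cst.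
    by apply: measurable_funD => //; apply: measurable_funM => //; exact: measurable_cst.
  apply: (splitting _ E) => //.
    by apply: (far u); [left|exact: (sub_sigmaI sk)|move=> w []].
  apply: (far (- u)); [by right|exact: (sub_sigmaD sk)|].
  move=> w [[[_ [Lb _]] Dw] Ew].
  have L0 : 0 < lyapunov (u / 4) a (Y1 k w) (Y2 k w) by exact: le_lt_trans Lb.
  have [//|] := lyapunov_gt0_side u01 (ltW N0) Dw L0.
  by rewrite mulNr.
have FACD : F k ((A `&` C) `\` D) by exact: (sub_sigmaD sk).
(* [lyap_in] in contrapositive form: L > b forces a radius of at least 8K, hence a position off
   0. *)
have HACD w : ((A `&` C) `\` D) w -> (8 * K) ^+ 2 <= sqnorm k w < N ^+ 2 /\ b < L k w.
  move=> [[_ [Lb _]] Dw]; split => //; apply/andP; split.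
    by rewrite leNgt; apply/negP => /lyap_in; rewrite leNgt => /negP; apply.
  by rewrite ltNge; apply/negP.
apply: (le_trans (escape_potential_step FACD HACD)).
have -> : (A `&` C) `\` D `\` many_zeros k n'.+1 1 =
    (A `&` C) `\` D `\` many_zeros k.+1 n' 1.
  have nz w : ((A `&` C) `\` D) w -> ~ zero_at k w.
    move=> /HACD[/andP[q0 _] _] [z1 z2]; move: q0.
    rewrite /sqnorm z1 z2 expr0n addr0 leNgt => /negP; apply.
    by rewrite exprn_gt0 // mulr_gt0.
  by apply/seteqP; split=> w [Aw nm]; split=> // m; apply: nm; move: m;
    rewrite /many_zeros /= zerosS_nonzero //; exact: nz.
by apply: IH; [exact: ltnW|exact: filtS].
Qed.

Lemma zeros_le k n1 n2 w : (n1 <= n2)%N -> (zeros k n1 w <= zeros k n2 w)%N.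
Proof.
move=> n12; rewrite /zero_count -(subnKC n12) big_split_ord /=.
exact: leq_addr.
Qed.

(* Here [j] upward steps of length at least [r] have been made, and [i] more, each
   of conditional probability at least [h], lead to positive potential. *)
Lemma avoid_zero_run (m n0 : nat) : (n0 < n)%N -> m%:R * K <= N + K ->
  (forall y1 y2 : R, m%:R * r <= y1 -> y1 ^+ 2 + y2 ^+ 2 <= (m%:R * K) ^+ 2 ->
    2 * b <= lyapunov (u / 4) a y1 y2) ->
  forall i j k A, (i + j = m)%N -> F k A ->
  (forall w, A w -> j%:R * r <= Y1 k w /\ sqnorm k w <= (j%:R * K) ^+ 2) ->
  h ^+ i * (b / B) * pr P A <= pr P (A `\` many_zeros k.+1 n0 1).
Proof.
move=> n0n mN lyap_start; have [r0 r1] := andP r01; have [h0 h1] := andP h01.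
elim=> [|i IH] j k A ijm FA HA; have mA := filt_sub FA.
  rewrite add0n in ijm; subst j; rewrite expr0 mul1r.
  apply: (@le_trans _ _ (pr P (A `\` many_zeros k n0.+1 1))); last first.
    apply: le_pr; [by apply: measurableD => //; exact: measurable_many_zeros
      |by apply: measurableD => //; exact: measurable_many_zeros|].
    move=> w [Aw nz]; split=> // mz; apply: nz; move: mz; rewrite /many_zeros /= zerosS.
    by move=> /leq_trans; apply; exact: leq_addl.
  apply: le_trans (avoid_zero_potential n0n FA).
  rewrite -Ex_indic // -ExZ; last exact: ebounded_indic.
  apply: le_Ex; [by apply: eboundedZ; exact: ebounded_indic
    |exact: (ebounded_restr FA (ebounded_potential k))|].
  apply: aeW => w; rewrite indicE.
  have [Aw|Aw] := pselect (A w); last by rewrite memNset // mulr0 mul0r.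
  rewrite mem_set // mulr1 mul1r; have [y1 q1] := HA w Aw.
  rewrite escape_potentialE; last first.
    have mK0 : 0 <= m%:R * K by rewrite mulr_ge0 // ltW.
    by apply: (le_trans q1); rewrite lerXn2r ?nnegrE ?(le_trans mK0 mN).
  rewrite le_max ler_pM2r ?invr_gt0 //; apply/orP; left.
  by have := lyap_start _ _ y1 q1; rewrite -/(L k w); lra.
pose E := [set w | r < sincr Y1 k w].
(* The jump bound may fail on a null set; intersecting with [J] costs no probability and bounds the
   position at every point of the event. *)
pose J := [set w | sincr Y1 k w ^+ 2 + sincr Y2 k w ^+ 2 <= K ^+ 2].
have ms1 : gmf k.+1 (sincr Y1 k).
  by apply: measurable_funB => //; exact: (filt_measurable_funS (mY1 k)).
have ms2 : gmf k.+1 (sincr Y2 k).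
  by apply: measurable_funB => //; exact: (filt_measurable_funS (mY2 k)).
have sk1 := filt_sigma k.+1.
have FE : F k.+1 E by apply: (sub_sigma_lt sk1) => //; exact: measurable_cst.
have FJ : F k.+1 J.
  apply: (sub_sigma_le sk1); last exact: measurable_cst.
  by apply: measurable_funD; exact: measurable_funX.
have FAE : F k.+1 (A `&` E) by apply: (sub_sigmaI sk1) => //; exact: filtS.
have FAEJ : F k.+1 (A `&` E `&` J) by exact: (sub_sigmaI sk1).
have hA : h * pr P A <= pr P (A `&` E `&` J).
  apply: (@le_trans _ _ (pr P (A `&` E))).
    have z : (1 : R) ^+ 2 + 0 ^+ 2 = 1 by rewrite expr1n expr0n addr0.
    have := pw_elliptic walk z FA; congr (_ <= pr P (_ `&` _)).
    by apply/funext => w; rewrite /E /= mul1r mul0r addr0.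
  apply: le_pr_ae; [exact: filt_sub FAE|exact: filt_sub FAEJ|].
  by apply: filterS (pw_jump walk k) => w Jw AEw; split.
have HA' w : (A `&` E `&` J) w ->
    j.+1%:R * r <= Y1 k.+1 w /\ sqnorm k.+1 w <= (j.+1%:R * K) ^+ 2.
  move=> [[Aw Ew] Jw]; have [y1 q1] := HA w Aw.
  have Y1E : Y1 k.+1 w = Y1 k w + sincr Y1 k w by rewrite /sincr addrC subrK.
  have Y2E : Y2 k.+1 w = Y2 k w + sincr Y2 k w by rewrite /sincr addrC subrK.
  rewrite -addn1 natrD !mulrDl !mul1r; split; first by rewrite Y1E lerD // ltW.
  rewrite /sqnorm Y1E Y2E.
  by apply: (sqr_norm_triangle _ (ltW K0) q1 Jw); rewrite mulr_ge0 // ltW.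
have ijm' : (i + j.+1 = m)%N by rewrite addnS -addSn.
have hi0 : 0 <= h ^+ i * (b / B) by rewrite mulr_ge0 ?exprn_ge0 ?divr_ge0 // ltW.
have -> : h ^+ i.+1 * (b / B) * pr P A = h ^+ i * (b / B) * (h * pr P A).
  by rewrite exprSr; ring.
apply: (le_trans (ler_wpM2l hi0 hA)); apply: (le_trans (IH _ _ _ ijm' FAEJ HA')).
apply: le_pr; [apply: measurableD; [exact: filt_sub FAEJ|exact: measurable_many_zeros]
  |by apply: measurableD => //; exact: measurable_many_zeros|].
move=> w [AEJw nz]; split; first by case: AEJw => -[].
move=> mz; apply: nz; move: mz; rewrite /many_zeros /= => /leq_trans; apply.
(* Y1 is positive at time k + 1, so the window can be shifted past that time; it is first lengthened
   by one so as not to end too early. *)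
apply: (leq_trans (zeros_le k.+1 w (leqnSn n0))); rewrite zerosS_nonzero //.
move=> [z1 _]; have [] := HA' w AEJw; rewrite z1 leNgt => /negP + _; apply.
by rewrite mulr_gt0.
Qed.

End Escape.

(** Induction on the length of the window. Off 0 at time [k], the window just moves on. At 0, a
    further zero has to come within n <= n0 steps, which has conditional probability at most 1 - p.
    Keeping the event of one zero on the right, instead of [A] alone, is what yields this factor
    from the induction hypothesis. *)
Lemma many_zeros_geometric (p : R) n0 : 0 <= p <= 1 ->
  (forall k A, F k A -> A `<=` zero_at k ->
    p * pr P A <= pr P (A `\` many_zeros k.+1 n0 1)) ->
  forall n j k A, (n <= n0.+1)%N -> F k A ->
  pr P (A `&` many_zeros k n j.+1) <= (1 - p) ^+ j * pr P (A `&` many_zeros k n 1).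
Proof.
move=> /andP[p0 p1] escape; have q0 : 0 <= 1 - p by rewrite subr_ge0.
have mm := measurable_many_zeros.
elim=> [|n IH] j k A nn0 FA.
  have -> : A `&` many_zeros k 0 j.+1 = set0.
    by apply/seteqP; split=> // w [_]; rewrite /many_zeros /= /zero_count big_ord0.
  by rewrite /pr measure0 /= mulr_ge0 ?exprn_ge0 ?fine_ge0.
have mA := filt_sub FA; pose Z := zero_at k; have FZ : F k Z by exact: zero_at_filt.
have mZ := filt_sub FZ.
rewrite (pr_split P (measurableI _ _ mA (mm k n.+1 j.+1)) mZ).
rewrite (pr_split P (measurableI _ _ mA (mm k n.+1 1)) mZ) mulrDr.
have FAZ : F k (A `&` Z) by exact: (sub_sigmaI (filt_sigma k)).
have FAZ' : F k (A `\` Z) by exact: (sub_sigmaD (filt_sigma k)).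
have mAZ := filt_sub FAZ.
apply: lerD; last first.
  have E i : (A `&` many_zeros k n.+1 i) `\` Z = (A `\` Z) `&` many_zeros k.+1 n i.
    apply/seteqP; split=> w.
      by move=> [[Aw +] Zw]; rewrite /many_zeros /= zerosS_nonzero.
    by move=> [[Aw Zw]]; rewrite /many_zeros /= => mz; do 2 split=> //; rewrite /= zerosS_nonzero.
  by rewrite !E; apply: IH; [exact: ltnW|exact: filtS].
have E i : (A `&` many_zeros k n.+1 i.+1) `&` Z = (A `&` Z) `&` many_zeros k.+1 n i.
  apply/seteqP; split=> w.
    by move=> [[Aw +] Zw]; rewrite /many_zeros /= zerosS_zero.
  by move=> [[Aw Zw]]; rewrite /many_zeros /= => mz; do 2 split=> //; rewrite /= zerosS_zero.
rewrite !E.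
have -> : (A `&` Z) `&` many_zeros k.+1 n 0 = A `&` Z.
  by apply/seteqP; split=> [w []//|w AZ]; split.
case: j => [|j].
  rewrite expr0 mul1r; apply: le_pr; [exact: measurableI|exact: mAZ|].
  by move=> w [].
apply: (le_trans (IH j _ _ (ltnW nn0) (filtS FAZ))).
rewrite exprSr -mulrA ler_wpM2l ?exprn_ge0 //.
apply: (@le_trans _ _ (pr P ((A `&` Z) `&` many_zeros k.+1 n0 1))).
  apply: le_pr; [exact: measurableI|exact: measurableI|].
  move=> w [AZ mz]; split=> //; move: mz; rewrite /many_zeros /= => /leq_trans; apply.
  exact: zeros_le.
rewrite mulrBl mul1r lerBrDr (pr_split P mAZ (mm k.+1 n0 1%N)) -(pr_split P mAZ (mm k.+1 n0 1%N)).
rewrite [leRHS](pr_split P mAZ (mm k.+1 n0 1%N)) lerD2l.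
by apply: escape => // w [].
Qed.

End PlanarWalk.

(** * Choice of the constants *)

Lemma sqr_powR_half (R : realType) (x : R) : 0 <= x -> (x ^+ 2) `^ (2^-1) = x.
Proof. by move=> x0; rewrite powR12_sqrt ?sqr_ge0 // sqrtr_sqr ger0_norm. Qed.

Lemma pos_mul_solve (R : realFieldType) (c x y : R) : 0 < c -> 0 < x -> 0 < y ->
  exists2 a, 0 < a & c * a * y = x.
Proof.
move=> c0 x0 y0; exists (x / (c * y)); first by rewrite divr_gt0 ?mulr_gt0.
by field; rewrite !gt_eqF.
Qed.

Lemma le1_powR (R : realType) (x a : R) : 1 <= x -> 0 <= a -> 1 <= x `^ a.
Proof. by move=> x1 a0; rewrite -[leLHS](powRr0 x) ler_powR. Qed.

(** Only N and B depend on n; they scale as n^(1/2) and n^(1/2-a). From 0, no return within n steps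
    has conditional probability at least h^m b / B: [m] forced steps, then the normalized potential
    reached by them. The window of length n + 1 covers the times 0 to n. *)
Lemma planar_walk_many_zeros (R : realType) (K r h u : R) :
  1 <= K -> 0 < r <= 1 -> 0 < h <= 1 -> 0 < u <= 1 ->
  exists a c : R, [/\ 0 < a < 1/2, 0 < c <= 1 &
    forall (disp : measure_display) (Omega : measurableType disp)
      (P : probability Omega R) (F : nat -> set (set Omega))
      (Y1 Y2 : nat -> Omega -> R),
    planar_walk P F Y1 Y2 K r h u ->
    forall n j, (0 < n)%N ->
    pr P (many_zeros Y1 Y2 0 n.+1 j.+1) <= (1 - c * n%:R `^ (- (1/2 - a))) ^+ j].
Proof.
move=> K1 r01 h01 u01.
have [r0 r1] := andP r01; have [h0 h1] := andP h01; have [u0 u1] := andP u01.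
have K0 : 0 < K by exact: lt_le_trans K1.
have K2 : 1 <= K ^+ 2 by rewrite expr_ge1 // ltW.
have K20 : 0 < K ^+ 2 by rewrite exprn_gt0.
have hr0 : 0 < h * r ^+ 2 by rewrite mulr_gt0 ?exprn_gt0.
have hr1 : h * r ^+ 2 <= 1.
  have : h * r ^+ 2 <= 1 * 1 by apply: ler_pM; rewrite ?sqr_ge0 ?expr_le1 // ltW.
  by rewrite mulr1.
have [a a0 aK] : exists2 a, 0 < a & 1856 * a * K ^+ 2 = u * (h * r ^+ 2 / 4).
  apply: pos_mul_solve; [by rewrite ltr0n|by apply: mulr_gt0 => //; exact: divr_gt0|exact: K20].
have uhr : u * (h * r ^+ 2) <= 1.
  have : u * (h * r ^+ 2) <= 1 * 1 by apply: ler_pM => //; rewrite ltW.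
  by rewrite mulr1.
have a4 : a <= 1/4.
  have : a * 1 <= a * K ^+ 2 by rewrite ler_pM2l.
  by clear -aK uhr a0; lra.
have a_small : 1856 * a * K ^+ 2 <= u * (h * r ^+ 2 / 4) by rewrite aK.
pose al := 1/2 - a; have al0 : 0 < al by rewrite /al; clear -a4; lra.
have al1 : al <= 2^-1 by rewrite /al; clear -a0; lra.
(* The bound of [lyapunov_le] on the ball of radius 8K. *)
have [b b1 bE] : exists2 b : R, 1 <= b & 2 * ((8 * K) ^+ 2) `^ al = b.
  exists (2 * ((8 * K) ^+ 2) `^ al) => //.
  have : 1 <= ((8 * K) ^+ 2) `^ al.
    apply: le1_powR (ltW al0); have K8 : 1 <= 8 * K by clear -K1; lra.
    by rewrite expr_ge1 // (le_trans _ K8).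
  by move: (_ `^ al) => x; clear; lra.
have b0 : 0 < b by exact: lt_le_trans b1.
(* After [m] steps, y1 >= m r and |y| <= m K give a Lyapunov value of at least m r (m K)^(-1/2), as
   2 a <= 1/2. This choice of [m] makes it at least 2 b. *)
have [m m0 mb] : exists2 m : nat, (0 < m)%N & 4 * b ^+ 2 * K < m%:R * r ^+ 2.
  exists (Num.truncn (4 * b ^+ 2 * K / r ^+ 2)).+1 => //.
  by rewrite -ltr_pdivrMr ?exprn_gt0 //; exact: truncnS_gt.
have m1 : 1 <= m%:R :> R by rewrite ler1n.
have mK1 : 1 <= m%:R * K by rewrite -[leLHS]mulr1 ler_pM.
have Ku : 0 <= 8 * K / u by rewrite divr_ge0 // ?mulr_ge0 // ltW.
(* N = CN sqrt n has to be at least [K], to leave room for the [m] initial steps, and to make (u/2)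
   N large enough for Chebyshev's inequality over n + 1 <= 2 n steps. *)
have [CN [CN1 uC mC KC]] : exists CN, [/\ 1 <= CN, 8 * K <= u * CN, m%:R * K <= CN & K <= CN].
  exists (8 * K / u + m%:R * K); have mKK : K <= m%:R * K by rewrite ler_peMl // ltW.
  split; rewrite ?lerDr //.
  - by rewrite (le_trans mK1) // lerDr.
  - by rewrite mulrDr mulrCA divff ?gt_eqF // mulr1 lerDl !mulr_ge0 // ltW.
  - by rewrite (le_trans mKK) // lerDr.
have CN0 : 0 < CN by exact: lt_le_trans CN1.
have c0 : 0 < h ^+ m / (8 * CN) by rewrite divr_gt0 ?exprn_gt0 ?mulr_gt0.
have c1 : h ^+ m / (8 * CN) <= 1.
  rewrite ler_pdivrMr ?mulr_gt0 // mul1r.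
  have : h ^+ m <= 1 by rewrite exprn_ile1 // ltW.
  by clear -CN1; lra.
exists a, (h ^+ m / (8 * CN)); split.
- by rewrite a0 /=; clear -a4; lra.
- by rewrite c0 c1.
move=> disp Omega P F Y1 Y2 walk n j n0.
have n1 : 1 <= n%:R :> R by rewrite ler1n.
have nR0 : 0 < n%:R :> R by exact: lt_le_trans n1.
pose N := CN * Num.sqrt n%:R.
have sn1 : 1 <= Num.sqrt n%:R :> R by rewrite -[leLHS]sqrtr1 ler_wsqrtr.
have CNN : CN <= N by rewrite /N ler_peMr // ltW.
have N0 : 0 < N by exact: lt_le_trans CNN.
have KN : K <= N.
  exact: le_trans CNN.
(* Within radius N + K <= 2 N, [lyapunov_le] gives at most 2 (2 CN)^(1-2a) n^(1/2-a) <= 4 CN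
   n^(1/2-a) = B / 2. *)
pose B := 8 * CN * n%:R `^ al.
have na0 : 0 < n%:R `^ al :> R by rewrite powR_gt0.
have B0 : 0 < B by rewrite !mulr_gt0 //.
have lyap_in (y1 y2 : R) : y1 ^+ 2 + y2 ^+ 2 < (8 * K) ^+ 2 -> lyapunov (u / 4) a y1 y2 <= b.
  move=> q; apply: (le_trans (lyapunov_le _ _ _ _)).
  - by clear -u0 u1; lra.
  - by rewrite a0 /=; clear -a4; lra.
  rewrite -bE ler_pM2l //; apply: ge0_ler_powR => //; last exact: ltW.
  - exact: ltW.
  - by rewrite nnegrE addr_ge0 ?sqr_ge0.
  - by rewrite nnegrE sqr_ge0.
have lyap_out (y1 y2 : R) : y1 ^+ 2 + y2 ^+ 2 <= (N + K) ^+ 2 -> lyapunov (u / 4) a y1 y2 <= B / 2.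
  move=> q; apply: (le_trans (lyapunov_le _ _ _ _)).
  - by clear -u0 u1; lra.
  - by rewrite a0 /=; clear -a4; lra.
  have q2 : y1 ^+ 2 + y2 ^+ 2 <= (2 * CN) ^+ 2 * n%:R.
    apply: (le_trans q).
    have -> : (2 * CN) ^+ 2 * n%:R = (2 * N) ^+ 2.
      by rewrite /N -[in LHS](sqr_sqrtr (ltW nR0)); ring.
    have NK0 : 0 <= N + K by rewrite addr_ge0 // ltW.
    have NK2 : N + K <= 2 * N by rewrite mulr_natl mulr2n lerD2l.
    by rewrite lerXn2r ?nnegrE // (le_trans NK0).
  have : (y1 ^+ 2 + y2 ^+ 2) `^ al <= ((2 * CN) ^+ 2 * n%:R) `^ al.
    apply: ge0_ler_powR => //; first exact: ltW.
    - by rewrite nnegrE addr_ge0 ?sqr_ge0.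
    - by rewrite nnegrE mulr_ge0 ?sqr_ge0 // ltW.
  rewrite powRM ?sqr_ge0 ?(ltW nR0) //.
  have CN2 : 1 <= (2 * CN) ^+ 2.
    have C2 : 1 <= 2 * CN by clear -CN1; lra.
    by rewrite expr_ge1 // (le_trans _ C2).
  have : ((2 * CN) ^+ 2) `^ al <= 2 * CN.
    rewrite -[leRHS](@sqr_powR_half R (2 * CN)) ?mulr_ge0 ?(ltW CN0) //.
    exact: ler_powR.
  rewrite -(ler_pM2r na0) -/al /B => h1' h2'.
  by have := le_trans h2' h1'; clear; lra.
have nR : n.+1%:R <= 2 * n%:R :> R by rewrite -[n.+1]addn1 natrD; clear -n1; lra.
have N_large : 8 * n.+1%:R * K ^+ 2 <= (u / 2 * N) ^+ 2.
  apply: (@le_trans _ _ (8 * (2 * n%:R) * K ^+ 2)).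
    by rewrite ler_pM2r // ler_pM2l.
  have -> : (u / 2 * N) ^+ 2 = (u * CN) ^+ 2 / 4 * n%:R.
    by rewrite /N -[in RHS](sqr_sqrtr (ltW nR0)); field.
  have : (8 * K) ^+ 2 <= (u * CN) ^+ 2.
    by rewrite lerXn2r ?nnegrE ?mulr_ge0 ?(ltW u0) ?(ltW CN0) ?(ltW K0).
  have -> : 8 * (2 * n%:R) * K ^+ 2 = (8 * K) ^+ 2 / 4 * n%:R by field.
  by rewrite ler_pM2r // => ?; rewrite ler_pM2r.
have mN : m%:R * K <= N + K.
  by rewrite (le_trans mC) // (le_trans CNN) // lerDl ltW.
have lyap_start (y1 y2 : R) : m%:R * r <= y1 -> y1 ^+ 2 + y2 ^+ 2 <= (m%:R * K) ^+ 2 ->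
    2 * b <= lyapunov (u / 4) a y1 y2.
  move=> y1m q; have mr0 : 0 < m%:R * r by rewrite mulr_gt0 // (lt_le_trans _ m1).
  have y10 : 0 < y1 by exact: lt_le_trans y1m.
  have u4 : 0 <= u / 4 by clear -u0; lra.
  apply: le_trans (le_lyapunov u4 (ltW a0) y10 q).
  set s := m%:R * K in mK1 q *.
  have s0 : 0 < s by exact: lt_le_trans mK1.
  apply: (@le_trans _ _ (m%:R * r * (Num.sqrt s)^-1)).
    rewrite ler_pdivlMr ?sqrtr_gt0 //.
    rewrite -ler_sqr ?nnegrE ?mulr_ge0 ?sqrtr_ge0 ?(ltW b0) ?(ltW r0) //.
    rewrite exprMn sqr_sqrtr ?(ltW s0) // /s.
    have := ler_wpM2l (ler0n R m) (ltW mb).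
    by clear; lra.
  apply: ler_pM => //; first exact: ltW.
  rewrite powRN lef_pV2 ?posrE ?powR_gt0 ?sqrtr_gt0 ?exprn_gt0 //.
  have s2 : 1 <= s ^+ 2 by rewrite expr_ge1 // ltW.
  apply: (@le_trans _ _ ((s ^+ 2) `^ (2^-1 * 2^-1))).
    by rewrite ler_powR //; move: a4; clear; lra.
  by rewrite powRrM sqr_powR_half ?(ltW s0) // powR12_sqrt // ltW.
pose p := h ^+ m / (8 * CN) * n%:R `^ (- al).
have nal : n%:R `^ (- al) = (n%:R `^ al)^-1 :> R by rewrite powRN.
have pB : p <= h ^+ m * (b / B).
  have -> : p = h ^+ m * (1 / B) by rewrite /p /B nal; field; rewrite !gt_eqF.
  by rewrite ler_pM2l ?exprn_gt0 // ler_pM2r ?invr_gt0.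
have p01 : 0 <= p <= 1.
  rewrite mulr_ge0 ?(ltW c0) ?powR_ge0 //=.
  have : p <= 1 * 1; last by rewrite mulr1.
  apply: ler_pM => //; first exact: ltW.
  by rewrite nal invf_le1 // le1_powR // ltW.
have escape k A : F k A -> A `<=` zero_at Y1 Y2 k ->
    p * pr P A <= pr P (A `\` many_zeros Y1 Y2 k.+1 n 1).
  move=> FA Az.
  apply: (@le_trans _ _ (h ^+ m * (b / B) * pr P A)).
    by rewrite ler_wpM2r ?pr_ge0.
  apply: (@avoid_zero_run _ _ _ P F Y1 Y2 K r h u walk K1 r01 h01 u01 a b B N n.+1 a0 a_small
    (ltW b0) B0 N0 lyap_in lyap_out N_large m n (ltnSn n) mN lyap_start m 0%N k A (addn0 m) FA).
  by move=> w /Az[-> ->]; rewrite !mul0r expr0n addr0.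
have FT : F 0%N setT.
  exact: (filt_measurableE walk 0 setT).1 measurableT.
have := many_zeros_geometric walk p01 escape j (leqnn n.+1) FT.
rewrite !setTI => /le_trans; apply; have /andP[_ p1] := p01.
by rewrite ler_piMr ?exprn_ge0 ?subr_ge0 // pr_le1 //; exact: measurable_many_zeros walk _ _ _.
Qed.

(** * Orthonormal coordinates in the plane *)

Section PlanarProjection.
Context {R : realType} {d : nat}.
Implicit Types (x y z : 'rV[R]_d) (L : {vspace 'rV[R]_d}).

Lemma dotpC x y : dotp x y = dotp y x.
Proof. by apply: eq_bigr => i _; rewrite mulrC. Qed.

Lemma dotpDl x y z : dotp (x + y) z = dotp x z + dotp y z.
Proof. by rewrite !dotpE mulmxDl mxE. Qed.

Lemma dotpZl (a : R) x y : dotp (a *: x) y = a * dotp x y.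
Proof. by rewrite !dotpE -scalemxAl mxE. Qed.

Lemma dotpDr x y z : dotp x (y + z) = dotp x y + dotp x z.
Proof. by rewrite dotpC dotpDl !(dotpC x). Qed.

Lemma dotpZr (a : R) x y : dotp x (a *: y) = a * dotp x y.
Proof. by rewrite dotpC dotpZl dotpC. Qed.

Lemma dotpBr x y z : dotp x (y - z) = dotp x y - dotp x z.
Proof. by rewrite dotpC dotpBl !(dotpC x). Qed.

Lemma dotp_ge0 x : 0 <= dotp x x.
Proof. by apply: sumr_ge0 => i _; rewrite -expr2 sqr_ge0. Qed.

Lemma sqr_enorm x : enorm x ^+ 2 = dotp x x.
Proof. by rewrite sqr_sqrtr // dotp_ge0. Qed.

Lemma enorm1 x : enorm x = 1 -> dotp x x = 1.
Proof. by move=> x1; rewrite -sqr_enorm x1 expr1n. Qed.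

Lemma orthonormal_completion L x : \dim L = 2%N -> x \in L -> dotp x x = 1 ->
  exists y, [/\ y \in L, dotp y y = 1 & dotp x y = 0].
Proof.
move=> dL xL x1.
have [v vL vx] : exists2 v, v \in L & v \notin <[x]>%VS.
  have /subvPn[v vL vx] : ~~ (L <= <[x]>)%VS; last by exists v.
  by apply/negP => /dimvS; rewrite dL dim_vline; case: (_ != _).
pose w := v - dotp v x *: x.
have wL : w \in L by rewrite rpredB // rpredZ.
have xw : dotp x w = 0 by rewrite dotpBr dotpZr x1 mulr1 (dotpC x) subrr.
have w0 : 0 < dotp w w.
  rewrite lt_neqAle dotp_ge0 andbT eq_sym; apply/eqP => /dotp_eq0 /eqP.
  rewrite subr_eq0 => /eqP vE; move: vx; rewrite vE => /negP; apply.
  by rewrite rpredZ // memv_line.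
exists ((enorm w)^-1 *: w); split; first exact: rpredZ.
  by rewrite dotpZl dotpZr mulrA -expr2 exprVn sqr_enorm mulVf // gt_eqF.
by rewrite dotpZr xw mulr0.
Qed.

Section OrthonormalPair.
Variables x y : 'rV[R]_d.
Hypotheses (x1 : dotp x x = 1) (y1 : dotp y y = 1) (xy0 : dotp x y = 0).

Lemma dotp_combination (a b : R) z : dotp z (a *: x + b *: y) = a * dotp z x + b * dotp z y.
Proof. by rewrite dotpDr !dotpZr. Qed.

Lemma sqr_norm_combination (a b : R) :
  dotp (a *: x + b *: y) (a *: x + b *: y) = a ^+ 2 + b ^+ 2.
Proof.
rewrite dotp_combination !dotpDl !dotpZl (dotpC y x) xy0 x1 y1; ring.
Qed.

Lemma bessel z : dotp z x ^+ 2 + dotp z y ^+ 2 <= dotp z z.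
Proof.
have := dotp_ge0 (z - (dotp z x *: x + dotp z y *: y)).
rewrite dotpBl !dotpBr sqr_norm_combination [dotp (_ + _) z]dotpC !dotp_combination; lra.
Qed.

Lemma orth_proj_plane L z : \dim L = 2%N -> x \in L -> y \in L ->
  orth_proj L z = dotp z x *: x + dotp z y *: y.
Proof.
move=> dL xL yL; apply: is_orth_proj_uniq (orth_projP L z) _.
split; first by rewrite rpredD // rpredZ.
suff LE : (L <= <[x]> + <[y]>)%VS.
  move=> v /(subvP LE) /memv_addP[_ /vlineP[a ->]] [_ /vlineP[b ->]] ->.
  rewrite dotp_combination !dotpBl !dotpDl !dotpZl (dotpC y x) x1 y1 xy0; ring.
have xynil : (<[x]> :&: <[y]> = 0)%VS.
  apply/eqP; rewrite -subv0; apply/subvP => v /memv_capP[/vlineP[a ->] /vlineP[b ab]].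
  have a0 : a = 0.
    have := congr1 (dotp x) ab; rewrite !dotpZr x1 xy0; lra.
  by rewrite a0 scale0r mem0v.
have sub : (<[x]> + <[y]> <= L)%VS by rewrite subv_add -!memvE xL.
have n0 (v : 'rV[R]_d) : dotp v v = 1 -> (v != 0).
  by move=> v1; apply/eqP => v0; move: v1; rewrite v0 -(scale0r 0) dotpZl mul0r => /eqP;
    rewrite eq_sym oner_eq0.
have /eqP-> : (<[x]> + <[y]>)%VS == L; last exact: subvv.
by rewrite eqEdim sub dL dimv_disjoint_sum // !dim_vline !n0.
Qed.

(** Free of division and polynomial in the coordinates, this form gives both the measurability of
    the cone event and, for |v| <= u, the bound of |v q| by p for a point (p, q) of the cone. It
    covers the vertex as well. *)
Lemma directed_coneE L (u : R) z : 0 < u -> \dim L = 2%N -> x \in L -> y \in L ->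
  directed_cone L x u z <->
  0 <= dotp z x /\ u ^+ 2 * (dotp z x ^+ 2 + dotp z y ^+ 2) <= dotp z x ^+ 2.
Proof.
move=> u0 dL xL yL; rewrite /directed_cone /= orth_proj_plane //.
set p := dotp z x; set q := dotp z y.
have pE : dotp (p *: x + q *: y) x = p.
  by rewrite dotpDl !dotpZl x1 (dotpC y) xy0; ring.
rewrite pE; set s := enorm _.
have s2 : s ^+ 2 = p ^+ 2 + q ^+ 2 by rewrite sqr_enorm sqr_norm_combination.
have s0 : 0 <= s by exact: sqrtr_ge0.
rewrite -s2 -exprMn; have [sz|sz] := eqVneq s 0.
  have pq0 : p *: x + q *: y = 0 by apply: dotp_eq0; rewrite -sqr_enorm -/s sz expr0n.
  split; last by left.
  by rewrite -pE pq0 sz -(scale0r 0) dotpZl mul0r mulr0.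
have sp : 0 < s by rewrite lt_neqAle eq_sym sz.
have us0 : 0 <= u * s by rewrite mulr_ge0 // ltW.
split=> [[H|]|[p0 usp]].
- by move: sz; rewrite /s /enorm H -(scale0r 0) dotpZl mul0r sqrtr0 eqxx.
- rewrite ler_pdivlMr // => usp; have p0 := le_trans us0 usp.
  by split=> //; rewrite lerXn2r.
- by right; rewrite ler_pdivlMr // -ler_sqr.
Qed.

End OrthonormalPair.
End PlanarProjection.

(** * From conditional expectations to inequalities over events *)

Section ConditionalBounds.
Context {disp : measure_display} {Omega : measurableType disp} {R : realType}.
Variables (P : probability Omega R) (G : set (set Omega)).
Hypotheses (sG : sigma_algebra setT G) (Gm : G `<=` measurable).
Implicit Types (f g : Omega -> R) (A E : set Omega).
Local Notation gmf := (measurable_fun (setT : set (g_sigma_algebraType G))).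
Local Notation pr := (pr P).

Lemma Rintegral_ae_ge0 A f : measurable A -> measurable_fun setT f ->
  {ae P, forall w, 0 <= f w} -> 0 <= \int[P]_(w in A) f w.
Proof.
move=> mA mf f0; rewrite /Rintegral.
rewrite (ae_eq_integral (fun w => (Num.max (f w) 0)%:E)) //.
- by rewrite fine_ge0 // integral_ge0 // => w _; rewrite lee_fin le_max lexx orbT.
- exact/measurable_EFinP/measurable_funTS.
- by apply/measurable_EFinP; apply: measurable_funTS; apply: measurable_maxr.
- by apply: filterS f0 => w f0 _ /=; rewrite max_l.
Qed.

Lemma Ex_restr A f : Ex P (fun w => \1_A w * f w) = \int[P]_(w in A) f w.
Proof.
by rewrite /Ex [RHS]Rintegral_mkcond patch_indic; congr Rintegral; apply/funext => w; rewrite mulrC.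
Qed.

(** The drift is defined coordinate by coordinate, while the cone condition concerns its scalar
    products with vectors. Integrability is carried through the induction because additivity of the
    integral needs it. *)
Lemma is_cond_exp_sum (I : Type) (s : seq I) (f g : I -> Omega -> R) (c : I -> R) :
  (forall i, P.-integrable setT (EFin \o f i)) ->
  (forall i, is_cond_exp P G (f i) (g i)) ->
  P.-integrable setT (EFin \o (fun w => \sum_(i <- s) f i w * c i)) /\
  is_cond_exp P G (fun w => \sum_(i <- s) f i w * c i)
                  (fun w => \sum_(i <- s) g i w * c i).
Proof.
move=> intf fg; elim: s => [|i s [IHf [mg intg IH]]].
  have i0 : P.-integrable setT (EFin \o (cst 0 : Omega -> R)).
    exact: ebounded_integrable (ebounded_cst P 0).
  have E (F : I -> Omega -> R) : (fun w => \sum_(i <- [::]) F i w * c i) = cst 0.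
    by apply/funext => w; rewrite big_nil.
  by rewrite !E; split=> //; split=> //; exact: measurable_cst.
have E (F : I -> Omega -> R) : (fun w => \sum_(i <- i :: s) F i w * c i) =
    (fun w => c i * F i w + \sum_(i <- s) F i w * c i).
  by apply/funext => w; rewrite big_cons mulrC.
have [mgi intgi fgi] := fg i.
have intZ F : P.-integrable setT (EFin \o F) -> P.-integrable setT (EFin \o (fun w => c i * F w)).
  by move=> h; have := integrableZl measurableT (c i) h.
have intD F F' : P.-integrable setT (EFin \o F) -> P.-integrable setT (EFin \o F') ->
    P.-integrable setT (EFin \o (fun w => F w + F' w)).
  by move=> h h'; have := integrableD measurableT h h'.
rewrite !E; split; first by apply: intD => //; exact: intZ.
split.
- by apply: measurable_funD => //; apply: measurable_funM => //; exact: measurable_cst.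
- by apply: intD => //; exact: intZ.
- move=> A GA; have mA := Gm GA.
  have H F F' : P.-integrable setT (EFin \o F) -> P.-integrable setT (EFin \o F') ->
    (\int[P]_(w in A) (c i * F w + F' w)%:E =
      (c i)%:E * \int[P]_(w in A) (F w)%:E + \int[P]_(w in A) (F' w)%:E)%E.
    move=> h h'; have hA F0 : P.-integrable setT (EFin \o F0) -> P.-integrable A (EFin \o F0).
      exact: integrableS.
    rewrite [LHS](@integralD_EFin _ _ _ P A mA (fun w => c i * F w) F'); [|exact/hA/intZ|exact: hA].
    by congr (_ + _)%E; rewrite -(integralZl mA (hA _ h)).
  by rewrite !H // fgi // IH.
Qed.

(** Integrating the conditional probability over the whole space gives P(E) = 1. *)
Lemma ae_of_cond_prob_eq1 E : measurable E ->
  {ae P, forall w, cond_prob P G E w = 1} -> {ae P, forall w, E w}.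
Proof.
move=> mE E1.
have intE := ebounded_integrable (ebounded_indic P mE).
have [mg intg /(_ setT)] := cond_expP sG Gm intE.
have GT : G setT by apply/(sub_sigma_measurable sG); exact: measurableT.
move=> /(_ GT); rewrite integral_indic // setIT.
have mg' := sub_sigma_measurable_fun sG Gm mg.
have -> : (\int[P]_w (cond_exp P G (\1_E) w)%:E = \int[P]_w (cst 1%E w))%E.
  apply: ae_eq_integral => //; first exact/measurable_EFinP.
  by apply: filterS E1 => w + _ /=; rewrite /cond_prob => ->.
rewrite integral_cst // mul1e [X in X = _ -> _]probability_setT => /esym PE.
apply/negligibleP; first exact: measurableC.
by rewrite [LHS](probability_setC P mE) PE subee.
Qed.

Lemma le_pr_of_cond_prob E A (h : R) : measurable E -> G A ->
  {ae P, forall w, h < cond_prob P G E w} -> h * pr A <= pr (A `&` E).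
Proof.
move=> mE GA hE; have mA := Gm GA.
have intE := ebounded_integrable (ebounded_indic P mE).
have [mg intg /(_ A GA)] := cond_expP sG Gm intE.
rewrite integral_indic // setIC /pr => /(congr1 fine) <-.
have mg' := sub_sigma_measurable_fun sG Gm mg.
have inth : P.-integrable A (EFin \o cst h).
  by apply: integrableS (ebounded_integrable (ebounded_cst P h)).
have <- : \int[P]_(w in A) (cst h w) = h * fine (P A) by rewrite Rintegral_cst.
rewrite -subr_ge0 -[X in 0 <= X - _]/(\int[P]_(w in A) cond_prob P G E w) -RintegralB //.
  apply: Rintegral_ae_ge0 => //; first by apply: measurable_funB => //; exact: measurable_cst.
  by apply: filterS hE => w; rewrite subr_ge0 => /ltW.
exact: integrableS intg.
Qed.

End ConditionalBounds.

(** * The projected process is a planar walk *)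

Section DirectedProcess.
Context {disp : measure_display} {Omega : measurableType disp} {R : realType} {d : nat}.
Variables (P : probability Omega R) (F : nat -> set (set Omega)) (X : nat -> Omega -> 'rV[R]_d).
Variables (L : {vspace 'rV[R]_d}) (l l2 : 'rV[R]_d) (K r h u : R).
Hypotheses (filtF : is_filtration F) (adX : adapted F X).
Hypotheses (h0 : 0 < h) (K0 : 0 < K).
Hypotheses (dL : \dim L = 2%N) (lL : l \in L) (l2L : l2 \in L).
Hypotheses (l1 : dotp l l = 1) (l21 : dotp l2 l2 = 1) (ll2 : dotp l l2 = 0).
Hypotheses (directed : strongly_directed_submartingale P F X u l L)
  (elliptic : uniformly_elliptic P F X h r) (jumps : bounded_jumps P X K).

Local Notation gmf n := (measurable_fun (setT : set (g_sigma_algebraType (F n)))).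

Let sF n : sigma_algebra setT (F n). Proof. by have [s _ _] := filtF. Qed.
Let Fm n : F n `<=` measurable. Proof. by have [_ m _] := filtF; exact: m. Qed.

Let gmfW m n (f : Omega -> R) : (m <= n)%N -> gmf m f -> gmf n f.
Proof.
have [_ _ Fl] := filtF => mn mf _ B mB.
apply/(sub_sigma_measurable (sF n))/(Fl _ _ mn)/(sub_sigma_measurable (sF m)).
exact: mf.
Qed.

Lemma gmf_dotp n (Z : Omega -> 'rV[R]_d) v : (forall i, gmf n (fun w => Z w 0 i)) ->
  gmf n (fun w => dotp (Z w) v).
Proof.
move=> mZ; apply: measurable_sum => i; apply: measurable_funM; [exact: mZ|exact: measurable_cst].
Qed.

Lemma gmf_incr n i : gmf n.+1 (fun w => incr X n w 0 i).
Proof.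
have -> : (fun w => incr X n w 0 i) = (fun w => X n.+1 w 0 i - X n w 0 i).
  by apply/funext => w; rewrite !mxE.
by apply: measurable_funB; [exact: adX|apply: (@gmfW n) => //; exact: adX].
Qed.

Let filt_mfun n (f : Omega -> R) : gmf n f -> measurable_fun setT f.
Proof. exact: sub_sigma_measurable_fun (sF n) (@Fm n) f. Qed.

Let bessel_incr n v1 v2 : dotp v1 v1 = 1 -> dotp v2 v2 = 1 -> dotp v1 v2 = 0 ->
  {ae P, forall w, dotp (incr X n w) v1 ^+ 2 + dotp (incr X n w) v2 ^+ 2 <= K ^+ 2}.
Proof.
move=> v11 v22 v12; apply: filterS (jumps n) => w jw.
apply: (le_trans (bessel v11 v22 v12 _)).
by rewrite -sqr_enorm lerXn2r ?nnegrE ?sqrtr_ge0 // ltW.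
Qed.

Lemma ebounded_incr n i : ebounded P (fun w => incr X n w 0 i).
Proof.
split; first by apply: (filt_mfun (n := n.+1)); exact: gmf_incr.
exists K; apply: filterS (jumps n) => w jw; apply: sqr_le_norm; first exact: ltW.
apply: (@le_trans _ _ (enorm (incr X n w) ^+ 2)); last first.
  by rewrite lerXn2r ?nnegrE ?sqrtr_ge0 // ltW.
rewrite sqr_enorm /dotp (bigD1 i) //= -expr2 lerDl sumr_ge0 // => j _.
by rewrite -expr2 sqr_ge0.
Qed.

Let gmf_drift n v : gmf n (fun w => dotp (drift P F X n w) v).
Proof.
apply: gmf_dotp => i.
have -> : (fun w => drift P F X n w 0 i) = cond_exp P (F n) (fun w => incr X n w 0 i).
  by apply/funext => w; rewrite mxE.
by have [] := cond_expP (sF n) (@Fm n) (ebounded_integrable (ebounded_incr n i)).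
Qed.

Lemma drift_is_cond_exp n v :
  is_cond_exp P (F n) (fun w => dotp (incr X n w) v) (fun w => dotp (drift P F X n w) v).
Proof.
have Hi i : P.-integrable setT (EFin \o (fun w => incr X n w 0 i)).
  exact: ebounded_integrable (ebounded_incr n i).
have Hc i : is_cond_exp P (F n) (fun w => incr X n w 0 i) (fun w => drift P F X n w 0 i).
  have -> : (fun w => drift P F X n w 0 i) = cond_exp P (F n) (fun w => incr X n w 0 i).
    by apply/funext => w; rewrite mxE.
  exact: cond_expP (sF n) (@Fm n) (Hi i).
by have [] := is_cond_exp_sum (@Fm n) (index_enum 'I_d) (v 0) Hi Hc.
Qed.

Lemma ae_drift_cone n : {ae P, forall w, directed_cone L l u (drift P F X n w)}.
Proof.
have [u0 cone1] := directed.
apply: (ae_of_cond_prob_eq1 (sF n) (@Fm n)) (cone1 n).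
pose p w := dotp (drift P F X n w) l; pose q w := dotp (drift P F X n w) l2.
have -> : [set w | directed_cone L l u (drift P F X n w)] =
    [set w | 0 <= p w] `&` [set w | u ^+ 2 * (p w ^+ 2 + q w ^+ 2) <= p w ^+ 2].
  by apply/seteqP; split=> w /(directed_coneE l1 l21 ll2 _ u0 dL lL l2L).
have mp : gmf n p by exact: gmf_drift.
have mq : gmf n q by exact: gmf_drift.
apply: (@Fm n); apply: (sub_sigmaI (sF n)); apply: (sub_sigma_le (sF n)) => //.
- by apply: measurable_funM; [exact: measurable_cst|
    apply: measurable_funD; exact: measurable_funX].
- exact: measurable_funX.
Qed.

(** The vectors l + v l2 with |v| <= u have nonnegative scalar product with every point of the cone,
    hence with the drift. All such [v] are allowed, since the planar walk uses the slope min(u,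
    1). *)
Lemma Ex_directed_ge0 n A v : F n A -> `|v| <= u ->
  0 <= Ex P (fun w => \1_A w * (dotp (incr X n w) l + v * dotp (incr X n w) l2)).
Proof.
move=> FA vu; have [u0 _] := directed; have mA := Fm FA.
have -> : (fun w => \1_A w * (dotp (incr X n w) l + v * dotp (incr X n w) l2)) =
    (fun w => \1_A w * dotp (incr X n w) (l + v *: l2)).
  by apply/funext => w; rewrite dotpDr dotpZr.
rewrite Ex_restr /Rintegral.
have [mD intD /(_ A FA) <-] := drift_is_cond_exp n (l + v *: l2).
apply: Rintegral_ae_ge0 => //; first exact: filt_mfun mD.
apply: filterS (ae_drift_cone n) => w /(directed_coneE l1 l21 ll2 _ u0 dL lL l2L)[].
rewrite dotpDr dotpZr; move: (dotp _ l) (dotp _ l2) => p q p0 upq.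
suff : `|v * q| <= p by rewrite ler_norml; lra.
apply: sqr_le_norm p0 _; apply: le_trans upq; rewrite exprMn.
have v2 : v ^+ 2 <= u ^+ 2.
  by rewrite -[v ^+ 2]real_normK ?num_real // lerXn2r ?nnegrE // ltW.
by apply: ler_pM; rewrite ?sqr_ge0 // lerDr sqr_ge0.
Qed.

Lemma elliptic_combination n A (a b : R) : a ^+ 2 + b ^+ 2 = 1 -> F n A ->
  h * pr P A <=
  pr P (A `&` [set w | r < a * dotp (incr X n w) l + b * dotp (incr X n w) l2]).
Proof.
move=> ab FA; pose v := a *: l + b *: l2.
have v1 : enorm v = 1 by rewrite /enorm sqr_norm_combination // ab sqrtr1.
have -> : [set w | r < a * dotp (incr X n w) l + b * dotp (incr X n w) l2] =
    [set w | r < dotp (incr X n w) v].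
  by apply/funext => w /=; rewrite dotp_combination.
apply: (le_pr_of_cond_prob (sF n) (@Fm n)) (elliptic n v1) => //.
apply: (@Fm n.+1); apply: (sub_sigma_lt (sF n.+1)); first exact: measurable_cst.
by apply: gmf_dotp => i; exact: gmf_incr.
Qed.

(** The new origin X_k is random but known to every sigma-algebra of the shifted filtration, and
    subtracting it leaves the increments unchanged. The planar estimates want constants of at most
    1; the conditions persist when [h] or [u] is lowered. *)
Lemma process_planar_walk k :
  planar_walk P (fun j => F (k + j)%N)
    (fun j w => dotp (X (k + j)%N w - X k w) l)
    (fun j w => dotp (X (k + j)%N w - X k w) l2)
    K r (Num.min h 1) (Num.min u 1).
Proof.
have [u0 _] := directed; have [_ _ Fle] := filtF.
have uu : 0 <= Num.min u 1 <= u by rewrite le_min (ltW u0) ler01 ge_min lexx.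
have E v n : sincr (fun j w => dotp (X (k + j)%N w - X k w) v) n =
    fun w => dotp (incr X (k + n) w) v.
  by apply/funext => w; rewrite /sincr -dotpBl addnS opprB addrA subrK.
have mX v n : gmf (k + n)%N (fun w => dotp (X (k + n)%N w - X k w) v).
  apply: gmf_dotp => i.
  have -> : (fun w => (X (k + n)%N w - X k w) 0 i) = (fun w => X (k + n)%N w 0 i - X k w 0 i).
    by apply/funext => w; rewrite !mxE.
  by apply: measurable_funB; [exact: adX|apply: (@gmfW k); [exact: leq_addr|exact: adX]].
split=> //.
- split=> [n|n|m n mn]; [exact: sF|exact: Fm|].
  by apply: Fle; rewrite leq_add2l.
- by move=> n; rewrite !E; exact: bessel_incr.
- move=> n A FA; rewrite !E; apply: Ex_directed_ge0 => //.
  by have /andP[? ?] := uu; rewrite ger0_norm.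
- move=> n A FA; rewrite !E.
  have /andP[u1 u2] := uu.
  have := @Ex_directed_ge0 (k + n)%N A (- Num.min u 1) FA.
  rewrite normrN ger0_norm // => /(_ u2); congr (0 <= Ex P _).
  by apply/funext => w; rewrite mulNr.
- move=> n A a b ab FA; rewrite !E; apply: le_trans (elliptic_combination ab FA).
  by rewrite ler_wpM2r ?pr_ge0 // ge_min lexx.
Qed.

End DirectedProcess.

(** * Local times and the range *)

Section Counting.
Context {disp : measure_display} {Omega : measurableType disp} {R : realType} {d : nat}.
Implicit Types X : nat -> Omega -> 'rV[R]_d.

Lemma measurable_eq_vector (Y Z : Omega -> 'rV[R]_d) :
  (forall i, measurable_fun setT (fun w => Y w 0 i)) ->
  (forall i, measurable_fun setT (fun w => Z w 0 i)) ->
  measurable [set w | Y w = Z w].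
Proof.
move=> mY mZ; pose f w := dotp (Y w - Z w) (Y w - Z w).
have mf : measurable_fun setT f.
  have E : f = (fun w => \sum_(i < d) (Y w 0 i - Z w 0 i) * (Y w 0 i - Z w 0 i)).
    by apply/funext => w; apply: eq_bigr => i _; rewrite !mxE.
  rewrite E; apply: measurable_sum => i; apply: measurable_funM;
    by apply: measurable_funB; [exact: mY|exact: mZ].
have -> : [set w | Y w = Z w] = setT `&` f @^-1` [set 0].
  rewrite setTI; apply/seteqP; split=> w /=.
    by move=> YZ; rewrite /f YZ subrr -(scale0r 0) dotpZl mul0r.
  by move=> /dotp_eq0/eqP; rewrite subr_eq0 => /eqP.
exact: mf.
Qed.

Lemma measurable_fun_nat_of_bool (b : Omega -> bool) :
  measurable [set w | b w] -> measurable_fun setT (fun w => (b w)%:R : R).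
Proof.
move=> mb; have -> : (fun w => (b w)%:R : R) = \1_[set w | b w].
  by apply/funext => w; rewrite indicE; congr ((nat_of_bool _)%:R); apply/idP/idP; rewrite inE.
exact: measurable_indic.
Qed.

Lemma measurable_gt_cst (f : Omega -> R) (c : R) : measurable_fun setT f ->
  measurable [set w | c < f w].
Proof.
move=> mf; have := measurable_fun_ltr (measurable_cst c) mf measurableT (Y := [set true]) I.
by rewrite setTI; congr measurable; apply/seteqP; split.
Qed.

Lemma measurable_lt_cst (f : Omega -> R) (c : R) : measurable_fun setT f ->
  measurable [set w | f w < c].
Proof.
move=> mf; have := measurable_fun_ltr mf (measurable_cst c) measurableT (Y := [set true]) I.
by rewrite setTI; congr measurable; apply/seteqP; split.
Qed.

Lemma in_visited X n w x :
  reflect (exists2 k, (k <= n)%N & X k w = x) (x \in visited X n w).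
Proof.
rewrite /visited; apply: (iffP (imfsetP _ _ _ _)) => [[k _ ->]|[k kn <-]].
  by exists k => //; rewrite -ltnS.
by rewrite -ltnS in kn; exists (Ordinal kn).
Qed.

Lemma visitedS X n w : visited X n.+1 w = (X n.+1 w |` visited X n w)%fset.
Proof.
apply/fsetP => x; rewrite in_fset1U; apply/in_visited/orP => [[k]|].
  rewrite leq_eqVlt => /orP[/eqP-> <-|kn Xk]; first by left.
  by right; apply/in_visited; exists k.
by move=> [/eqP->|/in_visited[k kn Xk]]; [exists n.+1|exists k => //; exact: leqW].
Qed.

Section Measurability.
Variable X : nat -> Omega -> 'rV[R]_d.
Hypothesis mX : forall n i, measurable_fun setT (fun w => X n w 0 i).

Lemma measurable_local_time n x : measurable_fun setT (fun w => (local_time X n x w)%:R : R).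
Proof.
have -> : (fun w => (local_time X n x w)%:R : R) = (fun w => \sum_(k < n.+1) (X k w == x)%:R).
  by apply/funext => w; rewrite /local_time natr_sum.
apply: measurable_sum => k; apply: measurable_fun_nat_of_bool.
have -> : [set w | X k w == x] = [set w | X k w = x] by apply/seteqP; split=> w /eqP.
by apply: measurable_eq_vector => // i; exact: measurable_cst.
Qed.

Lemma measurable_card_visited n : measurable_fun setT (fun w => (#|` visited X n w|)%:R : R).
Proof.
elim: n => [|n IH].
  have -> : (fun w => (#|` visited X 0 w|)%:R : R) = cst 1.
    apply/funext => w; have -> : visited X 0 w = [fset X 0%N w]%fset.
      apply/fsetP => x; rewrite inE; apply/in_visited/eqP => [[k]|->]; last by exists 0%N.
      by rewrite leqn0 => /eqP->.
    by rewrite cardfs1.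
  exact: measurable_cst.
have -> : (fun w => (#|` visited X n.+1 w|)%:R : R) =
    (fun w => (X n.+1 w \notin visited X n w)%:R + (#|` visited X n w|)%:R).
  by apply/funext => w; rewrite visitedS cardfsU1 natrD.
apply: measurable_funD => //; apply: measurable_fun_nat_of_bool.
have -> : [set w | X n.+1 w \notin visited X n w] =
    ~` \bigcup_(k in [set k | (k <= n)%N]) [set w | X k w = X n.+1 w].
  apply/seteqP; split=> w /=.
    by move=> /in_visited nv [k kn Xk]; apply: nv; exists k.
  by move=> nv; apply/in_visited => -[k kn Xk]; apply: nv; exists k.
apply: measurableC; apply: bigcup_measurable => k _.
exact: measurable_eq_vector.
Qed.

End Measurability.

Lemma sum_local_time X n w : (\sum_(x <- visited X n w) local_time X n x w = n.+1)%N.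
Proof.
rewrite /local_time exchange_big /= -[RHS]card_ord -sum1_card.
apply: eq_bigr => k _; have Xk : X k w \in visited X n w.
  by apply/in_visited; exists k => //; rewrite -ltnS.
transitivity (count_mem (X k w) (visited X n w)).
  rewrite -sum1_count [RHS]big_mkcond /=.
  by apply: eq_bigr => x _; rewrite eq_sym; case: (_ == _).
by rewrite count_uniq_mem ?fset_uniq // Xk.
Qed.

(** Pigeonhole: the local times of the visited sites add up to n + 1. *)
Lemma often_visited_point X n w (c : R) : (#|` visited X n w|)%:R * c < n.+1%:R ->
  exists2 x, x \in visited X n w & c < (local_time X n x w)%:R.
Proof.
move=> vc; apply: contrapT => nx.
have Lc x : x \in visited X n w -> (local_time X n x w)%:R <= c.
  by move=> xv; rewrite leNgt; apply/negP => h; apply: nx; exists x.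
move: vc; rewrite ltNge => /negP; apply.
rewrite -(sum_local_time X n w) natr_sum big_seq_cond.
apply: (@le_trans _ _ (\sum_(x <- visited X n w | (x \in visited X n w) && true) c)).
  by apply: ler_sum => x /andP[xv _]; exact: Lc.
by rewrite -big_seq_cond big_const_seq count_predT iter_addr_0 mulr_natl.
Qed.

(* Counting from the first visit to x on loses nothing, so only returns of
   the process re-rooted at its own random position matter. *)
Lemma local_time_le_returns X n w x : x \in visited X n w ->
  exists2 k, (k <= n)%N &
    (local_time X n x w <= \sum_(i < n.+1) (X (k + i)%N w == X k w))%N.
Proof.
move=> /in_visited[k0 k0n Xk0].
have ex : exists k, X k w == x by exists k0; rewrite Xk0.
case: (ex_minnP ex) => k /eqP Xk kmin.
have kn : (k <= n)%N by apply: leq_trans k0n; apply: kmin; rewrite Xk0.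
exists k => //; rewrite Xk /local_time.
rewrite -(big_mkord xpredT (fun i => nat_of_bool (X i w == x))).
rewrite -(big_mkord xpredT (fun i => nat_of_bool (X (k + i)%N w == x))).
rewrite (@big_cat_nat _ _ _ k) //=; last exact: leqW.
rewrite big_nat_cond big1 ?add0n => [|i /andP[/andP[_ ik] _]]; last first.
  by apply/eqP; rewrite eqb0; apply: contraL ik => /kmin; rewrite -leqNgt.
rewrite -{1}(add0n k) big_addn (@big_cat_nat _ _ _ (n.+1 - k) 0 n.+1) ?leq_subr //=.
apply: leq_trans (leq_addr _ _); apply: leq_sum => i _.
by rewrite addnC.
Qed.

End Counting.

(** The exponent n^(1/2-a/2) times q = n^(-(1/2-a)) is n^(a/2). Rounding the exponent down loses at
    most a factor exp(c q) <= e, because c and q are at most 1. *)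
Lemma geometric_le_expR (R : realType) (a c : R) (n : nat) :
  0 < a -> 0 < c <= 1 -> a < 1/2 -> (0 < n)%N ->
  (1 - c * n%:R `^ (- (1/2 - a))) ^+ Num.truncn (n%:R `^ (1/2 - a/2)) <=
  expR 1 * expR (- c * n%:R `^ (a/2)).
Proof.
move=> a0 /andP[c0 c1] a1 n0; set g := n%:R `^ (1/2 - a/2).
have n1 : 1 <= n%:R :> R by rewrite ler1n.
have nR0 : 0 < n%:R :> R by exact: lt_le_trans n1.
set q := n%:R `^ (- (1/2 - a)); have q0 : 0 <= q by exact: powR_ge0.
have q1 : q <= 1.
  by rewrite /q powRN invf_le1 ?powR_gt0 // le1_powR //; lra.
have cq1 : c * q <= 1 by rewrite -[leRHS]mulr1 ler_pM // ltW.
have qg : q * g = n%:R `^ (a/2).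
  rewrite /q /g -powRD; last by rewrite (gt_eqF nR0) implybT.
  by congr (_ `^ _); field.
have /andP[_ jg] := truncn_itv (powR_ge0 n%:R (1/2 - a/2)); rewrite -/g in jg.
set j := Num.truncn g in jg *.
apply: (@le_trans _ _ (expR (- (c * q)) ^+ j)).
  by rewrite lerXn2r ?nnegrE ?subr_ge0 ?expR_ge0 //; exact: expR_ge1Dx.
rewrite -expRM_natl -expRD ler_expR -qg.
have : q * c * g <= q * c * (j.+1%:R) by rewrite ler_wpM2l ?mulr_ge0 ?(ltW c0) // ltW.
by rewrite -[j.+1]addn1 natrD; lra.
Qed.

Theorem theorem1p4 (R : realType) (d : nat) (K r h u : R) :
  (2 <= d)%N -> 1 <= K -> 0 < r -> r <= 1 -> 0 < h -> 0 < u ->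
  exists gamma C1 C2 delta : R,
    [/\ 0 < gamma < 1 / 2, 0 < C1, 0 < C2, 0 < delta &
    forall (Sites : set 'rV[R]_d) (L : {vspace 'rV[R]_d}) (l : 'rV[R]_d)
      (disp : measure_display) (Omega : measurableType disp)
      (P : probability Omega R) (F : nat -> set (set Omega))
      (X : nat -> Omega -> 'rV[R]_d),
      infinite_set Sites -> Sites 0 ->
      \dim L = 2%N -> l \in L -> enorm l = 1 ->
      is_filtration F -> adapted F X -> (forall n w, Sites (X n w)) ->
      strongly_directed_submartingale P F X u l L ->
      uniformly_elliptic P F X h r ->
      bounded_jumps P X K ->
      (forall x, Sites x -> {ae P, forall w, X 0%N w = x} ->
        forall n : nat,
          (P [set w | (n%:R `^ gamma < (local_time X n x w)%:R)%R] <=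
             (C1 * expR (- C2 * n%:R `^ delta))%:E)%E) /\
      (forall n : nat,
        (P [set w | ((#|` visited X n w|)%:R < n%:R `^ (1 - gamma))%R] <=
           (C1 * n%:R * expR (- C2 * n%:R `^ delta))%:E)%E)].
Proof.
move=> d2 K1 r0 r1 h0 u0; have K0 : 0 < K by exact: lt_le_trans K1.
have h01 : 0 < Num.min h 1 <= 1 by rewrite lt_min h0 ltr01 ge_min lexx orbT.
have u01 : 0 < Num.min u 1 <= 1 by rewrite lt_min u0 ltr01 ge_min lexx orbT.
have r01 : 0 < r <= 1 by rewrite r0.
have [a [c [/andP[a0 a1] c01 planar]]] := planar_walk_many_zeros K1 r01 h01 u01.
have [c0 _] := andP c01.
have e0 : 0 < expR 1 :> R by exact: expR_gt0.
have g0 : 0 < 1/2 - a/2 by lra.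
(* The exponent gamma lies halfway between 1/2 - a and 1/2, so that n^gamma trials, each escaping
   with probability c n^(-(1/2-a)), leave n^(a/2) in the exponential. In C1, e pays for rounding
   n^gamma down and 2 for n + 1 <= 2 n. *)
exists (1/2 - a/2), (2 * expR 1), c, (a/2); split=> //.
- by rewrite g0 /=; lra.
- by rewrite mulr_gt0.
move=> Sites L l disp Omega P F X _ _ dL lL /enorm1 l1 filtF adX _ directed elliptic jumps.
have [l2 [l2L l21 ll2]] := orthonormal_completion dL lL l1.
have walk k := process_planar_walk filtF adX K0 dL lL l2L l1 l21 ll2 directed elliptic jumps k.
have mX n i : measurable_fun setT (fun w => X n w 0 i).
  have [sF Fm _] := filtF.
  by apply: (sub_sigma_measurable_fun (sF n) (Fm n)); exact: adX.
(* Frequent returns to the position at time [k] during the n + 1 times from [k] on. Only projections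
   to the plane are compared, which can only increase the count. *)
pose M k n := many_zeros (fun j w => dotp (X (k + j)%N w - X k w) l)
  (fun j w => dotp (X (k + j)%N w - X k w) l2) 0 n.+1 (Num.truncn (n%:R `^ (1/2 - a/2) : R)).+1.
have mM k n : measurable (M k n) by exact: measurable_many_zeros (walk k) _ _ _.
have prM k n : (0 < n)%N -> pr P (M k n) <= expR 1 * expR (- c * n%:R `^ (a/2)).
  by move=> n0; apply: le_trans (geometric_le_expR a0 c01 a1 n0); exact: planar (walk k) _ _ n0.
have inM k n w : n%:R `^ (1/2 - a/2) < (\sum_(i < n.+1) (X (k + i)%N w == X k w))%N%:R :> R ->
    M k n w.
  move=> many; rewrite /M /many_zeros /=.
  apply: (@leq_trans (\sum_(i < n.+1) (X (k + i)%N w == X k w))).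
    rewrite -(ltr_nat R); apply: le_lt_trans many.
    by have /andP[] := truncn_itv (powR_ge0 n%:R (1/2 - a/2)).
  rewrite /zero_count; apply: leq_sum => i _; rewrite add0n; case: eqP => // ->.
  by rewrite subrr -(scale0r 0) !dotpZl !mul0r eqxx.
have expR0n n : 0 <= expR 1 * expR (- c * n%:R `^ (a/2)) :> R by rewrite mulr_ge0 ?expR_ge0.
split=> [x _ X0x n|n].
- have mL : measurable [set w | n%:R `^ (1/2 - a/2) < (local_time X n x w)%:R :> R].
    by apply: measurable_gt_cst; exact: measurable_local_time.
  rewrite (prE P mL) lee_fin.
  (* For n = 0 the power n^(a/2) is 0 and the bound is 2 e >= 1. *)
  have [->|n0] := posnP n.
    rewrite [X in expR (_ * X)]powR0 ?gt_eqF ?divr_gt0 // mulr0 expR0 mulr1.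
    apply: (le_trans (pr_le1 P _)); first by apply: measurable_gt_cst; exact: measurable_local_time.
    have := expR_ge1Dx (1 : R); lra.
  apply: (@le_trans _ _ (pr P (M 0%N n))); last first.
    by apply: (le_trans (prM _ _ n0)); rewrite -mulrA ler_peMl // ler1n.
  apply: le_pr_ae => //; apply: filterS X0x => w X0x.
  by move=> many; apply: inM; rewrite X0x; exact: many.
have mV : measurable [set w | (#|` visited X n w|)%:R < n%:R `^ (1 - (1/2 - a/2)) :> R].
  by apply: measurable_lt_cst; exact: measurable_card_visited.
rewrite (prE P mV) lee_fin.
(* For n = 0 the threshold n^(1-gamma) is 0, and no cardinality lies below it. *)
have [->|n0] := posnP n.
  rewrite mulr0 mul0r powR0; last by rewrite gt_eqF //; lra.
  rewrite (_ : [set _ | _] = set0) ?/pr ?measure0 //.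
  by apply/seteqP; split=> // w /=; rewrite ltrn0.
have nR0 : 0 < n%:R :> R by rewrite ltr0n.
apply: (@le_trans _ _ (pr P (\big[setU/set0]_(k < n.+1) M k n))).
  apply: le_pr => //; first by apply: bigsetU_measurable => k _.
  move=> w /= vn.
  have [|x /local_time_le_returns[k kn Lk] xn] :=
      @often_visited_point _ _ _ _ X n w (n%:R `^ (1/2 - a/2)).
    (* The exponents 1 - gamma and gamma add up to 1, so the product is n < n + 1. *)
    apply: (@lt_trans _ _ (n%:R `^ (1 - (1/2 - a/2)) * n%:R `^ (1/2 - a/2))).
      by rewrite ltr_pM2r ?powR_gt0.
    rewrite -powRD ?subrK ?powRr1 ?(ltW nR0) ?ltr_nat //.
    by rewrite (gt_eqF nR0) implybT.
  rewrite -(bigcup_mkord n.+1 (M^~ n)); exists k => //=; apply: inM.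
  by apply: (lt_le_trans xn); rewrite ler_nat.
have Ubound m : pr P (\big[setU/set0]_(k < m) M k n) <=
    m%:R * (expR 1 * expR (- c * n%:R `^ (a/2))).
  elim: m => [|m IH]; first by rewrite big_ord0 mul0r /pr measure0.
  rewrite big_ord_recr /=; set U := \big[setU/set0]_(k < m) _.
  have mU : measurable U by apply: bigsetU_measurable => k _.
  have -> : U `|` M m n = U `|` (M m n `\` U).
    apply/seteqP; split=> w /= [Uw|Mw]; [by left| |by left|by right; case: Mw].
    by have [Uw|Uw] := pselect (U w); [left|right].
  rewrite prU; [|exact: mU|exact: measurableD|by rewrite setIDA setDE setIAC setICr set0I].
  rewrite -[m.+1]addn1 natrD mulrDl mul1r lerD //.
  by apply: le_trans (prM m n n0); apply: le_pr; [exact: measurableD|exact: mM|move=> w []].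
apply: (le_trans (Ubound n.+1)).
have -> : 2 * expR 1 * n%:R * expR (- c * n%:R `^ (a/2)) =
    (2 * n%:R) * (expR 1 * expR (- c * n%:R `^ (a/2))) by ring.
rewrite ler_wpM2r // -natrM ler_nat mul2n -addnn -addn1 leq_add2l //.
Qed.
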